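(* Let $p\ge5$ be a prime and $G=\mathrm{Gal}(\bar{\mathbb{Q}}/\mathbb{Q})$. Let $\pi:G\to\mathrm{GL}_2(\mathcal{O}_\Lambda)\subset\mathrm{GL}_2(E_\Lambda)$ be the Galois representation described in the context, so that $\tilde\pi(G)=\mathrm{PSL}_2(\mathbb{F}_p)$. Let $K=\mathbb{Q}(i)$, $H=\mathrm{Gal}(\bar{\mathbb{Q}}/K)$, let $s\in G$ be complex conjugation (so $s^2=1$ and $\{1,s\}$ is a set of representatives of the $H$-cosets in $G$), and let $\rho=\mathrm{Ind}_H^G(\pi|_H)$. Then: (1) $\mathrm{PSL}_2(\mathbb{F}_p)\rtimes\mathbb{Z}/2\mathbb{Z}$ is realizable as a Galois group over $\mathbb{Q}$, for the semidirect product law of $\tilde\rho(G)\cong\tilde\rho(H)\rtimes G/H$, where $\tilde\rho(H)\cong\mathrm{PSL}_2(\mathbb{F}_p)$ and the nontrivial element $sH$ of $G/H\cong\mathbb{Z}/2\mathbb{Z}$ acts by conjugation by $\tilde\rho(s)$. (2) The semidirect product in part (1) is direct if and only if $\tilde\pi(s)=I$. (3) The automorphism $\phi_{\tilde\rho(s)}$ of $\tilde\rho(H)$ given by conjugation by $\tilde\rho(s)$ is inner. (4) The group obtained in part (1) is not isomorphic to $\mathrm{PGL}_2(\mathbb{F}_p)$.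
   Context: Let $E$ be a number field, $\Lambda$ a prime of its ring of integers, $E_\Lambda$ the completion, $\mathcal{O}_\Lambda$ its ring of integers, $\mathbb{F}_\Lambda$ its residue field. For a continuous homomorphism $\pi:G\to\mathrm{GL}_m(E_\Lambda)$ with $\pi(G)\subset\mathrm{GL}_m(\mathcal{O}_\Lambda)$, $\tilde\pi:G\to\mathrm{PGL}_m(\mathbb{F}_\Lambda)$ denotes reduction modulo $\Lambda$ followed by passage to the projective group. Here $\pi$ is Deligne's representation attached to a non-CM newform $f$ of weight $k>1$ on $\Gamma_1(N)$ and a prime $\Lambda$ above $p$, where $f$ and $\Lambda$ are chosen (as is possible for every $p\ge5$ by Zywina, ''Modular forms and some cases of the Inverse Galois Problem'') such that the image of $\tilde\pi$ in $\mathrm{PGL}_2(\mathbb{F}_\Lambda)$ is $\mathrm{PSL}_2(\mathbb{F}_p)$. The induced representation $\rho$ acts on $V=\{f:G\to W \mid f(hg)=\pi(h)f(g)\ \forall h\in H,g\in G\}$, $W=E_\Lambda^2$ with standard basis $w_1,w_2$, by $(\rho(g)f)(x)=f(xg)$. It is written in the basis $\phi_{1,w_1},\phi_{1,w_2},\phi_{s,w_1},\phi_{s,w_2}$ of $V$, where $\phi_{t,w}(g)=\pi(gt^{-1})w$ if $gt^{-1}\in H$ and $0$ otherwise; then $\rho(G)\subset\mathrm{GL}_4(\mathcal{O}_\Lambda)$ and $\tilde\rho:G\to\mathrm{PGL}_4(\mathbb{F}_\Lambda)$ is defined. The sequence $1\to\tilde\rho(H)\to\tilde\rho(G)\to G/H\to1$,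 $\tilde\rho(g)\mapsto gH$, is exact. ''The semidirect product is direct'' means that the action of $\mathbb{Z}/2\mathbb{Z}$ on the normal factor is trivial. *)

(* Defs.v *)
From HB Require Import structures.
From mathcomp Require Import all_boot all_order all_fingroup all_solvable.
From mathcomp Require Import all_algebra all_field.
From mathcomp Require Import all_classical all_reals all_analysis.
From mathcomp Require complex.
Import complex.ComplexField complex.
Import Order.TTheory GRing.Theory Num.Theory numFieldNormedType.Exports.

Set Implicit Arguments.
Unset Strict Implicit.
Unset Printing Implicit Defensive.

Local Open Scope ring_scope.

(* algC is an algebraic closure of Q, and a field automorphism of algC        *)
(* automatically fixes Q: galQ is Gal(Qbar / Q).                             *)
Definition field_aut (f : algC -> algC) : Prop :=
  [/\ f 1 = 1, {morph f : x y / x + y}, {morph f : x y / x * y} & bijective f].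

Record galQ := GalQ { gal_fun :> algC -> algC; galP : field_aut gal_fun }.

Lemma galQ_ext (g h : galQ) : g =1 h -> g = h.
Proof.
case: g h => [f fP] [f' f'P] /= /funext eqff'; subst f'.
by congr GalQ; exact: Prop_irrelevance.
Qed.

Lemma field_aut1 : field_aut idfun.
Proof. by split=> //; exists id. Qed.

Lemma field_autM f g : field_aut f -> field_aut g -> field_aut (f \o g).
Proof.
move=> [f1 fD fM fB] [g1 gD gM gB]; split=> [|x y|x y|].
- by rewrite /= g1 f1.
- by rewrite /= gD fD.
- by rewrite /= gM fM.
- exact: bij_comp.
Qed.

Lemma field_autV (g : galQ) :
  {f : algC -> algC | field_aut f /\ cancel g f /\ cancel f g}.
Proof.
apply: cid; case: (galP g) => g1 gD gM [f fK gK]; exists f.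
split=> //; split=> [|x y|x y|]; last by exists g.
- by rewrite -g1 fK.
- by apply: (can_inj fK); rewrite gD !gK.
- by apply: (can_inj fK); rewrite gM !gK.
Qed.

HB.instance Definition _ := gen_eqMixin galQ.
HB.instance Definition _ := gen_choiceMixin galQ.

Definition galQ_one : galQ := GalQ field_aut1.
Definition galQ_mul (g h : galQ) : galQ := GalQ (field_autM (galP g) (galP h)).
Definition galQ_inv (g : galQ) : galQ := GalQ (proj1 (svalP (field_autV g))).

Lemma galQ_mulA : associative galQ_mul.
Proof. by move=> f g h; exact: galQ_ext. Qed.
Lemma galQ_mul1 : left_id galQ_one galQ_mul.
Proof. by move=> g; exact: galQ_ext. Qed.
Lemma galQ_1mul : right_id galQ_one galQ_mul.
Proof. by move=> g; exact: galQ_ext. Qed.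
Lemma galQ_mulV : left_inverse galQ_one galQ_inv galQ_mul.
Proof.
by move=> g; apply: galQ_ext => x /=; case: field_autV => f /= [_ [-> _]].
Qed.
Lemma galQ_Vmul : right_inverse galQ_one galQ_inv galQ_mul.
Proof.
by move=> g; apply: galQ_ext => x /=; case: field_autV => f /= [_ [_ ->]].
Qed.

HB.instance Definition _ := isGroup.Build galQ
  galQ_mulA galQ_mul1 galQ_1mul galQ_mulV galQ_Vmul.

Lemma conjC_field_aut : field_aut (fun x : algC => x^*).
Proof.
split; [exact: rmorph1 | exact: rmorphD | exact: rmorphM |].
by exists (fun x : algC => x^*) => x; exact: conjCK.
Qed.

Definition complex_conj : galQ := GalQ conjC_field_aut.

Definition in_Qi (x : algC) : Prop :=
  exists a b : rat, x = ratr a + ratr b * 'i.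

Definition gal_over_Qi (g : galQ) : Prop := forall x, in_Qi x -> g x = x.

Definition is_rep (G : groupType) (F : fieldType) (m : nat)
    (pi : G -> 'M[F]_m) : Prop :=
  pi 1%g = 1%:M /\ forall g h : G, pi (g * h)%g = pi g *m pi h.

(* Induction of pi from the subgroup H to G = H u Hs; ind_basis is the family *)
(* phi_{1,w_1}, .., phi_{1,w_m}, phi_{s,w_1}, .., phi_{s,w_m}.               *)
Section Induction.

Variables (G : groupType) (F : fieldType) (m : nat).
Variables (H : G -> Prop) (pi : G -> 'M[F]_m).

Definition ind_space (f : G -> 'cV[F]_m) : Prop :=
  forall h g : G, H h -> f (h * g)%g = pi h *m f g.

Definition ind_act (g : G) (f : G -> 'cV[F]_m) : G -> 'cV[F]_m :=
  fun x => f (x * g)%g.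

Definition ind_phi (t : G) (w : 'cV[F]_m) : G -> 'cV[F]_m :=
  fun g => if `[< H (g * t^-1)%g >] then pi (g * t^-1)%g *m w else 0.

Variable s : G.

Definition ind_basis (j : 'I_(m + m)) : G -> 'cV[F]_m :=
  match fintype.split j with
  | inl i => ind_phi 1%g (delta_mx i 0)
  | inr i => ind_phi s (delta_mx i 0)
  end.

Definition ind_matrix (rho : G -> 'M[F]_(m + m)) : Prop :=
  forall (g : G) (j : 'I_(m + m)) (x : G),
    ind_act g (ind_basis j) x = \sum_i rho g i j *: ind_basis i x.

Hypothesis pi_rep : is_rep pi.
Hypothesis H_1 : H 1%g.
Hypothesis H_M : forall g h, H g -> H h -> H (g * h)%g.
Hypothesis H_V : forall g, H g -> H g^-1%g.
Hypothesis s_repr : ~ H s /\ forall g, H g \/ H (g * s^-1)%g.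

Lemma ind_act_space g f : ind_space f -> ind_space (ind_act g f).
Proof. by move=> fV h x Hh; rewrite /ind_act -mulgA (fV h). Qed.

Lemma ind_phi_space t w : ind_space (ind_phi t w).
Proof.
move=> h g Hh; rewrite /ind_phi -mulgA.
have -> : `[< H (h * (g * t^-1))%g >] = `[< H (g * t^-1)%g >].
  apply: asbool_equiv_eq; split=> Hhg; last exact: H_M.
  by rewrite -(mulKg h (g * t^-1)%g); apply: H_M => //; exact: H_V.
by case: ifP => _; rewrite ?mulmx0 // (pi_rep.2 h) mulmxA.
Qed.

Lemma ind_basis_space j : ind_space (ind_basis j).
Proof. by rewrite /ind_basis; case: (fintype.split j) => i; exact: ind_phi_space. Qed.

Lemma ind_comb_at1 (c : 'I_(m + m) -> F) :
  \sum_j c j *: ind_basis j 1%g = \col_i c (lshift m i).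
Proof.
rewrite big_split_ord /= [X in _ + X]big1 ?addr0 => [|i _]; last first.
  rewrite /ind_basis -[rshift m i]/(unsplit (inr i)) unsplitK /ind_phi mul1g.
  case: asboolP => [/H_V|_]; last by rewrite scaler0.
  by rewrite invgK => /s_repr.1.
transitivity (\sum_i c (lshift m i) *: delta_mx i 0 : 'cV[F]_m).
  apply: eq_bigr => i _.
  rewrite /ind_basis -[lshift m i]/(unsplit (inl i)) unsplitK /ind_phi mulgV.
  by case: asboolP => // _; rewrite pi_rep.1 mul1mx.
by rewrite [RHS]matrix_sum_delta; apply: eq_bigr => i _; rewrite big_ord1 mxE.
Qed.

Lemma ind_comb_ats (c : 'I_(m + m) -> F) :
  \sum_j c j *: ind_basis j s = \col_i c (rshift m i).
Proof.
rewrite big_split_ord /= [X in X + _]big1 ?add0r => [|i _]; last first.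
  rewrite /ind_basis -[lshift m i]/(unsplit (inl i)) unsplitK /ind_phi invg1 mulg1.
  by case: asboolP => [/s_repr.1 //|_]; rewrite scaler0.
transitivity (\sum_i c (rshift m i) *: delta_mx i 0 : 'cV[F]_m).
  apply: eq_bigr => i _.
  rewrite /ind_basis -[rshift m i]/(unsplit (inr i)) unsplitK /ind_phi mulgV.
  by case: asboolP => // _; rewrite pi_rep.1 mul1mx.
by rewrite [RHS]matrix_sum_delta; apply: eq_bigr => i _; rewrite big_ord1 mxE.
Qed.

(* ind_basis is a basis of ind_space, so ind_matrix determines rho.          *)
Lemma ind_basis_free (c : 'I_(m + m) -> F) :
  (forall x, \sum_j c j *: ind_basis j x = 0) -> forall j, c j = 0.
Proof.
move=> c0 j; rewrite -[j]splitK; case: (fintype.split j) => i /=.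
  by have /colP/(_ i) := c0 1%g; rewrite ind_comb_at1 !mxE.
by have /colP/(_ i) := c0 s; rewrite ind_comb_ats !mxE.
Qed.

Lemma ind_basis_span f : ind_space f ->
  exists c : 'I_(m + m) -> F, forall x, f x = \sum_j c j *: ind_basis j x.
Proof.
move=> fV; pose c j := match fintype.split j with
  | inl i => f 1%g i 0 | inr i => f s i 0 end.
exists c.
have sumV h g : H h -> \sum_j c j *: ind_basis j (h * g)%g =
    pi h *m \sum_j c j *: ind_basis j g.
  move=> Hh; rewrite mulmx_sumr; apply: eq_bigr => j _.
  by rewrite (ind_basis_space _ _ Hh) scalemxAr.
move=> x; case: (s_repr.2 x) => Hx.
  rewrite -[x]mulg1 fV // sumV // ind_comb_at1; congr (_ *m _).
  by apply/colP => i; rewrite mxE /c -[lshift m i]/(unsplit (inl i)) unsplitK.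
rewrite -[x](mulgVK s) fV // sumV // ind_comb_ats; congr (_ *m _).
by apply/colP => i; rewrite mxE /c -[rshift m i]/(unsplit (inr i)) unsplitK.
Qed.

Lemma ind_matrix_ex : exists rho, ind_matrix rho.
Proof.
have /choice[rho rhoP] : forall gj : G * 'I_(m + m),
    exists c : 'I_(m + m) -> F, forall x,
      ind_act gj.1 (ind_basis gj.2) x = \sum_i c i *: ind_basis i x.
  by move=> [g j]; apply/ind_basis_span/ind_act_space/ind_basis_space.
exists (fun g => \matrix_(i, j) rho (g, j) i) => g j x.
by rewrite (rhoP (g, j)); apply: eq_bigr => i _; rewrite mxE.
Qed.

End Induction.

Section Projective.

Variables (n : nat) (F : finFieldType).
Local Open Scope group_scope.

Definition GL_scalars : {set {'GL_n.+1[F]}} :=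
  [set x | is_scalar_mx (GLval x)]%SET.

Lemma GL_scalars_group_set : group_set GL_scalars.
Proof.
apply/group_setP; split=> [|x y].
  by rewrite inE GL_1E; apply/is_scalar_mxP; exists 1%R.
rewrite !inE GL_ME => /is_scalar_mxP[a ->] /is_scalar_mxP[b ->].
by apply/is_scalar_mxP; exists (a * b)%R; exact/esym/scalar_mxM.
Qed.
Canonical GL_scalars_group := Group GL_scalars_group_set.

Definition SL : {set {'GL_n.+1[F]}} := [set x | \det (GLval x) == 1%R]%SET.

Lemma SL_group_set : group_set SL.
Proof.
apply/group_setP; split=> [|x y]; rewrite !inE ?GL_1E ?GL_ME ?det1 //.
by move=> /eqP dx /eqP dy; rewrite [\det _]det_mulmx dx dy mulr1.
Qed.
Canonical SL_group := Group SL_group_set.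

Definition PGL : {group coset_of GL_scalars} :=
  ([set: {'GL_n.+1[F]}] / GL_scalars)%G.

Definition PSL : {group coset_of GL_scalars} := (SL_group / GL_scalars)%G.

(* Class in PGL_n+1(F) of a matrix, which must be invertible: on a singular  *)
(* matrix the value is 1.                                                    *)
Definition proj_class (M : 'M[F]_n.+1) : coset_of GL_scalars :=
  coset GL_scalars (insubd (1 : {'GL_n.+1[F]}) M).

End Projective.

(* Image of PSL_n+1(F_p) in PGL_n+1(F), for F of characteristic p.           *)
Definition PSL_Fp_in (n p : nat) (F : finFieldType) :
    {set coset_of (GL_scalars n F)} :=
  [set proj_class (map_mx (fun a : 'F_p => (a : nat)%:R : F) (GLval x))
    | x in SL n 'F_p]%SET.

Definition img (G : Type) (gT : finGroupType) (H : G -> Prop) (f : G -> gT) :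
    {set gT} := [set y | `[< exists2 g, H g & f g = y >]]%SET.

Definition galois_group_over_Q (gT : finGroupType) (A : {set gT}) : Prop :=
  exists L : splittingFieldType rat,
    galois 1%VS {:L} /\ ('Gal({:L} / 1%VS) \isog A)%g.

Definition prime_ideal (F : fieldType) (A P : F -> Prop) : Prop :=
  [/\ forall x, P x -> A x,
      P 0 /\ (forall x y, P x -> P y -> P (x + y)),
      forall a x, A a -> P x -> P (a * x),
      ~ P 1 &
      forall a b, A a -> A b -> P (a * b) -> P a \/ P b].

(* P ^ n as an ideal of A: finite sums of products.                          *)
Fixpoint ideal_exp (F : fieldType) (A P : F -> Prop) (n : nat) : F -> Prop :=
  if n is n'.+1 then
    fun x => exists s : seq (F * F),
      (forall u, u \in s -> P u.1 /\ ideal_exp A P n' u.2) /\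
      x = \sum_(u <- s) u.1 * u.2
  else A.

Definition ring_of_integers (E : fieldExtType rat) (x : E) : Prop :=
  integralOver (intr : int -> E) x.

(* v >= n, with the convention v(0) = +oo                                    *)
Definition val_ge (K : fieldType) (v : K -> int) (n : int) (x : K) : Prop :=
  x = 0 \/ n <= v x.

Definition val_ring (K : fieldType) (v : K -> int) (x : K) : Prop :=
  val_ge v 0 x.

(* (K, iota, v) is the completion of E at the nonzero prime Lambda, with its *)
(* normalised discrete valuation v (the value of v at 0 being irrelevant).   *)
Record is_completion (E : fieldExtType rat) (Lambda : E -> Prop)
    (K : fieldType) (iota : {rmorphism E -> K}) (v : K -> int) : Prop := {
  cpl_mul : forall x y : K, x != 0 -> y != 0 -> v (x * y) = v x + v y;
  cpl_add : forall (n : int) (x y : K),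
    val_ge v n x -> val_ge v n y -> val_ge v n (x + y);
  cpl_ext : forall (n : nat) (a : E), ring_of_integers a ->
    val_ge v n%:Z (iota a) <-> ideal_exp (@ring_of_integers E) Lambda n a;
  cpl_dense : forall (x : K) (n : int),
    exists a : E, val_ge v n (x - iota a);
  cpl_complete : forall u : nat -> K,
    (forall n : int, exists N : nat, forall i j : nat,
       (N <= i)%N -> (N <= j)%N -> val_ge v n (u i - u j)) ->
    exists l : K, forall n : int, exists N : nat, forall i : nat,
       (N <= i)%N -> val_ge v n (u i - l)
}.

(* red is the reduction map from the valuation ring of v onto its residue    *)
(* field k, extended arbitrarily to K.                                       *)
Record is_residue_map (K : fieldType) (v : K -> int) (k : fieldType)
    (red : K -> k) : Prop := {
  red_1 : red 1 = 1;
  red_D : forall x y, val_ring v x -> val_ring v y ->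
    red (x + y) = red x + red y;
  red_M : forall x y, val_ring v x -> val_ring v y ->
    red (x * y) = red x * red y;
  red_surj : forall a : k, exists2 x, val_ring v x & red x = a;
  red_ker : forall x, val_ring v x -> (red x = 0 <-> val_ge v 1 x)
}.

(* Continuity for the Krull topology on galQ and the v-adic topology.        *)
Definition gal_continuous (K : fieldType) (v : K -> int) (m : nat)
    (pi : galQ -> 'M[K]_m) : Prop :=
  forall (g : galQ) (n : int), exists S : seq algC, forall h : galQ,
    {in S, h =1 g} -> forall i j, val_ge v n (pi h i j - pi g i j).

Definition mx_integral (K : fieldType) (v : K -> int) (m : nat)
    (M : 'M[K]_m) : Prop := forall i j, val_ring v (M i j).

Section ModularForms.

Variable R : realType.
Local Notation C := (complex R).
Implicit Types (z : C) (f g : C -> C).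

Definition upper z : Prop := 0 < complex.Im z.

Definition mobius (A : 'M[int]_2) z : C :=
  ((A 0 0)%:~R * z + (A 0 1)%:~R) / ((A 1 0)%:~R * z + (A 1 1)%:~R).

(* Weight k slash operator, for matrices of determinant 1.                   *)
Definition slash (k : nat) (A : 'M[int]_2) f : C -> C := fun z =>
  ((A 1 0)%:~R * z + (A 1 1)%:~R) ^- k * f (mobius A z).

Definition SL2Z (A : 'M[int]_2) : Prop := \det A = 1.

Definition Gamma0 (N : nat) (A : 'M[int]_2) : Prop :=
  SL2Z A /\ (N %| (A 1 0)%R)%Z.

Definition Gamma1 (N : nat) (A : 'M[int]_2) : Prop :=
  [/\ Gamma0 N A, (N %| (A 0 0 - 1)%R)%Z & (N %| (A 1 1 - 1)%R)%Z].

Definition holomorphic_upper f : Prop :=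
  forall z, upper z -> derivable (f : C^o -> C^o) (z : C^o) (1 : C^o).

Definition zero_at_infty f : Prop :=
  forall e : R, 0 < e -> exists B : R, forall z,
    B < complex.Im z -> `|f z| < e%:C%C.

(* S_k(Gamma_1(N)); only the values of f on the upper half-plane matter.     *)
Definition cusp_form (k N : nat) f : Prop :=
  [/\ holomorphic_upper f,
      forall A, Gamma1 N A -> forall z, upper z -> slash k A f z = f z &
      forall A, SL2Z A -> zero_at_infty (slash k A f)].

(* exp (2 i pi z) *)
Definition qexp z : C :=
  (expR (- (2 * pi * complex.Im z)))%:C%C *
  Complex (cos (2 * pi * complex.Re z)) (sin (2 * pi * complex.Re z)).

Definition fourier_coefs (a : nat -> C) f : Prop :=
  forall z, upper z ->
    (((fun n => \sum_(i < n) a i * qexp z ^+ i) : nat -> C^o) @ \oo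
       --> (f z : C^o))%classic.

Definition dirichlet_char (N : nat) (chi : int -> C) : Prop :=
  [/\ chi 1 = 1,
      forall a b, chi (a * b) = chi a * chi b,
      forall a, chi (a + N%:Z) = chi a &
      forall a, (chi a != 0) = coprimez a N].

(* Hecke operator T_l, l prime, on the forms of weight k and nebentypus eps. *)
Definition hecke (k : nat) (eps : int -> C) (l : nat) f : C -> C := fun z =>
  l%:R^-1 * (\sum_(j < l) f ((z + j%:R) / l%:R)) +
  eps l * l%:R ^+ k.-1 * f (l%:R * z).

(* Representatives of Gamma_1(N) \ SL_2(Z).                                  *)
Definition Gamma1_reps (N : nat) (s : seq 'M[int]_2) : Prop :=
  [/\ uniq s,
      forall A, A \in s -> SL2Z A,
      forall A, SL2Z A -> exists B D, [/\ Gamma1 N B, D \in s & A = B *m D] &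
      forall B D D', Gamma1 N B -> D \in s -> D' \in s ->
        D' = B *m D -> D' = D].

Definition fund_domain : set (R * R) :=
  [set w | [/\ `|w.1| <= 2^-1, 1 <= w.1 ^+ 2 + w.2 ^+ 2 & 0 < w.2]]%classic.

(* Petersson product on S_k(Gamma_1(N)), k >= 2, up to a positive factor:    *)
(* the integral over a fundamental domain of Gamma_1(N) is folded onto the   *)
(* standard one of SL_2(Z) by means of the representatives in s.             *)
Definition petersson_fun (k : nat) (s : seq 'M[int]_2) f g (w : R * R) : C :=
  (\sum_(A <- s) slash k A f (Complex w.1 w.2) *
                 (slash k A g (Complex w.1 w.2))^*) *
  (w.2 ^+ (k - 2))%:C%C.

Definition petersson (k : nat) (s : seq 'M[int]_2) f g : C :=
  let mu := (@lebesgue_measure R \x @lebesgue_measure R)%E in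
  Complex
    (Rintegral mu fund_domain (fun w => complex.Re (petersson_fun k s f g w)))
    (Rintegral mu fund_domain (fun w => complex.Im (petersson_fun k s f g w))).

(* Orthogonality to the old subspace of S_k(Gamma_1(N)).                     *)
Definition orthogonal_to_old (k N : nat) f : Prop :=
  forall (s : seq 'M[int]_2) (M d : nat) (g : C -> C),
    Gamma1_reps N s -> (M %| N)%N -> (M < N)%N -> (d %| N %/ M)%N ->
    cusp_form k M g -> petersson k s f (fun z => g (d%:R * z)) = 0.

(* f is a newform of weight k on Gamma_1(N), with nebentypus eps and Fourier *)
(* expansion \sum_n a_n q^n.                                                 *)
Record newform (k N : nat) (eps : int -> C) (a : nat -> C) f : Prop := {
  nf_cusp : cusp_form k N f;
  nf_fourier : fourier_coefs a f;
  nf_char : dirichlet_char N eps;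
  nf_nebentypus : forall A, Gamma0 N A ->
    forall z, upper z -> slash k A f z = eps (A 1 1) * f z;
  nf_hecke : forall l : nat, prime l ->
    exists c : C, forall z, upper z -> hecke k eps l f z = c * f z;
  nf_normalized : a 1%N = 1;
  nf_new : orthogonal_to_old k N f
}.

Definition has_CM (N : nat) (a : nat -> C) : Prop :=
  exists (D : nat) (phi : int -> C),
    [/\ (0 < D)%N, dirichlet_char D phi,
        exists2 n : int, coprimez n D & phi n != 1 &
        forall l : nat, prime l -> ~~ (l %| D * N)%N ->
          phi l * a l = a l].

End ModularForms.

Definition prime_of_Zbar_over (l : nat) (L : algC -> Prop) : Prop :=
  prime_ideal (fun x => x \in Aint) L /\ L l%:R.

Definition inertia (L : algC -> Prop) (g : galQ) : Prop :=
  forall x, x \in Aint -> L (g x - x).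

(* Arithmetic Frobenius elements at a prime L over l.                        *)
Definition is_frobenius (l : nat) (L : algC -> Prop) (g : galQ) : Prop :=
  forall x, x \in Aint -> L (g x - x ^+ l).

(* pi is a matrix form over the completion (K, iota, v) of E of the          *)
(* representation attached to the newform of level N, weight k, nebentypus   *)
(* eps and Fourier coefficients a_n, these lying in E via tau.               *)
Definition attached_rep (R : realType) (E : fieldExtType rat)
    (tau : {rmorphism E -> complex R}) (K : fieldType)
    (iota : {rmorphism E -> K}) (v : K -> int) (k N p : nat)
    (eps : int -> complex R) (a : nat -> complex R)
    (pi : galQ -> 'M[K]_2) : Prop :=
  [/\ is_rep pi, gal_continuous v pi &
      forall (l : nat) (L : algC -> Prop),
        prime l -> ~~ (l %| N * p)%N -> prime_of_Zbar_over l L ->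
        (forall g, inertia L g -> pi g = 1%:M) /\
        (forall g, is_frobenius l L g ->
          exists al el : E,
            [/\ tau al = a l, tau el = eps l, \tr (pi g) = iota al &
                \det (pi g) = iota (el * l%:R ^+ k.-1)])].

(* Main.v *)
From HB Require Import structures.
Require Import Defs.
From mathcomp Require Import all_boot all_order all_fingroup all_solvable.
From mathcomp Require Import all_algebra all_field.
From mathcomp Require Import all_classical all_reals all_analysis.
From mathcomp Require Import ring.
From mathcomp Require complex.
Import complex.ComplexField complex.
Import Order.TTheory GRing.Theory Num.Theory.

Set Implicit Arguments.
Unset Strict Implicit.
Unset Printing Implicit Defensive.

Local Open Scope ring_scope.

(** Put s for complex conjugation, H for the stabilizer of 'i, and pit, rhot for
    the projective reductions of pi and rho.  In the basis of the phi_{t,w},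
    an element h of H acts by the block matrix diag(pi h, pi (s h s^-1)), while
    an element outside H acts by an antidiagonal block matrix.  Since
    pi (s h s^-1) is conjugate to pi h, the reduction of rho g is scalar if and
    only if g lies in H and the reduction of pi g is scalar
    ([map_red_induced_scalar]).  Hence rhot(H) and pit(H) are the same quotient
    of H.

    The group pit(H) is all of PSL_2(F_p): it contains the square of every
    element of pit(G) = PSL_2(F_p), since H has index 2, and for p odd
    SL_2(F_p) is generated by transvections, which are squares
    ([SL2_generated_by_squares]).  Write q for pit followed by the
    identification of pit(G) with PSL_2(F_p), and c for q s.  Conjugation by
    rhot s becomes conjugation by c on PSL_2(F_p); as c lies in
    PSL_2(F_p) = q(H), this automorphism is inner, and it is trivial exactly
    when c = 1, because PSL_2(F_p) has trivial center.

    The action being inner, in the external semidirect product the element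
    zeta = (generator of Z/2) * c is central of order 2, and
    g |-> zeta^[g notin H] * q g is a homomorphism of G onto the semidirect
    product with the kernel of rhot ([semidirect_structure]).  This yields the
    isomorphism with rhot(G); and the central element zeta excludes
    PGL_2(F_p), whose center is trivial ([PSL2_centralizer]).

    Finally, rhot is trivial on the automorphisms that fix 'i and the finitely
    many algebraic numbers provided by the continuity of pi at 1, and a finite
    quotient of Gal(Qbar / Q) with this property is the Galois group of the
    fixed field of the kernel ([finite_quotient_galois]). *)

(** * Homomorphisms from subgroups of infinite groups *)

(** A predicate, of the kind taken by [img], because [galQ] is infinite. *)
Definition subgroup_pred (G : groupType) (H : G -> Prop) : Prop :=
  [/\ H 1%g, forall g h, H g -> H h -> H (g * h)%g &
      forall g, H g -> H g^-1%g].

Definition hom_on (G G' : groupType) (H : G -> Prop) (f : G -> G') : Prop :=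
  forall g h, H g -> H h -> f (g * h)%g = (f g * f h)%g.

Lemma subgroup_predT (G : groupType) : subgroup_pred (fun _ : G => True).
Proof. by []. Qed.

Section HomOn.

Variables (G G' : groupType) (H : G -> Prop) (f : G -> G').
Hypotheses (H_subgroup : subgroup_pred H) (f_hom : hom_on H f).

Lemma hom_on1 : f 1%g = 1%g.
Proof.
have [H1 _ _] := H_subgroup; apply: (mulgI (f 1%g)).
by rewrite -f_hom // !mulg1.
Qed.

Lemma hom_onV g : H g -> f g^-1%g = (f g)^-1%g.
Proof.
have [_ _ HV] := H_subgroup => Hg; apply: (mulgI (f g)).
by rewrite -f_hom ?mulgV ?hom_on1 //; exact: HV.
Qed.

Lemma hom_on_eq g h : H g -> H h -> f g = f h <-> f (g * h^-1)%g = 1%g.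
Proof.
have [_ _ HV] := H_subgroup => Hg Hh.
rewrite f_hom // ?hom_onV //; last exact: HV.
by split=> [->|/divg1_eq//]; rewrite mulgV.
Qed.

End HomOn.

Lemma imgP (T : Type) (gT : finGroupType) (H : T -> Prop) (f : T -> gT) y :
  reflect (exists2 g, H g & f g = y) (y \in img H f).
Proof. by rewrite inE; exact: asboolP. Qed.

Lemma mem_img (T : Type) (gT : finGroupType) (H : T -> Prop) (f : T -> gT) g :
  H g -> f g \in img H f.
Proof. by move=> Hg; apply/imgP; exists g. Qed.

Lemma img_group_set (G : groupType) (gT : finGroupType) (H : G -> Prop)
  (f : G -> gT) : subgroup_pred H -> hom_on H f -> group_set (img H f).
Proof.
move=> sH homf; have [H1 HM _] := sH; apply/group_setP; split.
  by rewrite -(hom_on1 sH homf) mem_img.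
move=> _ _ /imgP[g Hg <-] /imgP[h Hh <-]; rewrite -homf //.
by apply: mem_img; exact: HM.
Qed.

(** Two finite images of one group are isomorphic as soon as the kernels agree:
    both are the quotient by that kernel, which is infinite here and so is
    compared elementwise. *)
Lemma factor_isom (G : groupType) (aT bT : finGroupType) (H : G -> Prop)
    (f : G -> aT) (g : G -> bT) :
    subgroup_pred H -> hom_on H f -> hom_on H g ->
    (forall x, H x -> f x = 1%g <-> g x = 1%g) ->
  exists psi : {morphism img H f >-> bT},
    isom (img H f) (img H g) psi /\ forall x, H x -> psi (f x) = g x.
Proof.
move=> sH homf homg eqker; have [H1 HM HV] := sH.
have eqfg x y : H x -> H y -> f x = f y <-> g x = g y.
  move=> Hx Hy; rewrite (hom_on_eq sH homf) // (hom_on_eq sH homg) //.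
  by apply: eqker; apply: HM => //; exact: HV.
have psiP y : {x | y \in img H f -> H x /\ f x = y}.
  apply: cid; have [/imgP[x]|_] := boolP (y \in img H f); last by exists 1%g.
  by exists x.
pose psi y := g (sval (psiP y)).
have psiE x : H x -> psi (f x) = g x.
  move=> Hx; have [Hy fy] := svalP (psiP (f x)) (mem_img f Hx).
  by apply/eqfg.
have psiM : {in img H f &, {morph psi : x y / (x * y)%g}}.
  move=> _ _ /imgP[x Hx <-] /imgP[y Hy <-].
  by rewrite -homf // !psiE // ?homg //; exact: HM.
exists (Morphism psiM); split=> //.
pose F := Group (img_group_set sH homf).
apply: (@sub_isom _ _ F (Morphism (psiM : {in F &, _}))) => //.
  apply/setP=> y; apply/morphimP/imgP => [[_ _ /imgP[x Hx <-] ->]|[x Hx <-]].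
    by exists x; rewrite //= psiE.
  by exists (f x); rewrite ?mem_img //= psiE.
apply/injmP => _ _ /imgP[x Hx <-] /imgP[y Hy <-] /=.
by rewrite !psiE // => /(eqfg _ _ Hx Hy).
Qed.

(** * Finite quotients of the absolute Galois group are Galois groups *)

(** The field generated by all the roots of a rational polynomial is a
    splitting field; the factorization descends from [algC] because the
    embedding of the number field is injective on polynomials. *)
Lemma normal_num_field (rs : seq algC) (q : {poly rat}) :
    \prod_(r <- rs) ('X - r%:P) = map_poly ratr q ->
  exists (L : splittingFieldType rat) (QsC : {rmorphism L -> algC}) (s : seq L),
    map QsC s = rs /\ <<1 & s>>%VS = fullv.
Proof.
move=> Dq; have [Qs [QsC [s Ds genQs]]] := num_field_exists rs.
have split_Qs : SplittingField.axiom Qs.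
  exists (\prod_(z <- s) ('X - z%:P)); last by exists s; rewrite ?eqpxx.
  suff -> : \prod_(z <- s) ('X - z%:P) = map_poly (in_alg Qs) q.
    by apply/polyOverP => i; rewrite coef_map; exact: rpredZ (mem1v _).
  apply: (map_poly_inj QsC); rewrite -map_poly_comp rmorph_prod.
  have -> : map_poly (QsC \o in_alg Qs) q = map_poly ratr q.
    by apply: eq_map_poly => a /=; rewrite alg_num_field fmorph_rat.
  rewrite -Dq -Ds big_map; apply: eq_bigr => z _; exact: map_polyXsubC.
pose L : splittingFieldType rat :=
  HB.pack (FieldExt.sort Qs) (FieldExt_isSplittingField.Build rat Qs split_Qs).
by exists L, QsC, s.
Qed.

Lemma galois_num_field (L : splittingFieldType rat) : galois 1 {:L}.
Proof.
apply/and3P; split; [exact: sub1v | | exact: normalFieldf].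
apply/separableP => x _; apply: pcharf0_separable => l.
by rewrite (fmorph_pchar (in_alg L)) pchar_num.
Qed.

Lemma field_aut_rmorphism (nu : {rmorphism algC -> algC}) : field_aut nu.
Proof.
split; [exact: rmorph1 | exact: rmorphD | exact: rmorphM |].
exists (algC_invaut nu); [exact: algC_autK | exact: algC_invautK].
Qed.

Lemma galQ_rmorphism (g : galQ) : {nu : {rmorphism algC -> algC} | nu =1 g}.
Proof.
case: g => f [f1 fD fM fB].
have f0 : f 0 = 0 by apply: (addrI (f 0)); rewrite -fD !addr0.
have fN : {morph f : x / - x}.
  by move=> x; apply: (addrI (f x)); rewrite -fD !subrr.
have fA : zmod_morphism f by move=> x y; rewrite fD fN.
pose nu : {rmorphism algC -> algC} := HB.pack f (GRing.isZmodMorphism.Build _ _ f fA)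
  (GRing.isMonoidMorphism.Build _ _ f (conj f1 fM)).
by exists nu.
Qed.

(** The product of [gal_of] composes maps in the order opposite to that of
    [galQ], hence [res g] is the inverse of the restriction of [g].  It is onto
    since an automorphism of a number field extends to [algC]. *)
Lemma galQ_restriction (L : splittingFieldType rat)
    (QsC : {rmorphism L -> algC}) :
  exists res : galQ -> gal_of {:L},
    [/\ {morph res : g h / (g * h)%g},
        forall (g : galQ) x, g (QsC (res g x)) = QsC x &
        forall u, exists g, res g = u].
Proof.
have galE (u : gal_of {:L}) x : (u^-1)%g (u x) = x.
  by rewrite -galM ?memvf // mulgV gal_id.
have /choice[res resP] : forall g : galQ, exists u : gal_of {:L},
    forall x, QsC (u x) = g (QsC x).
  move=> g; have [nu Dnu] := galQ_rmorphism g.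
  have [nu0 nu0P] := restrict_aut_to_normal_num_field QsC nu.
  pose f : 'End(L) := linfun nu0.
  have /(kAut_to_gal (K := 1%AS))[u _ Du] : kAut 1 {:L} f.
    rewrite kAutfE; apply/kHom_lrmorphism; split=> [x y|]; rewrite !lfunE /=.
      exact: rmorphM.
    exact: rmorph1.
  by exists u => x; rewrite -Du ?memvf // lfunE /= nu0P Dnu.
have res_onto (u : gal_of {:L}) : exists g, res g = u.
  have [nu nuP] := extend_algC_subfield_aut QsC u.
  exists (GalQ (field_aut_rmorphism nu)); apply/eqP/gal_eqP => x _.
  by apply: (fmorph_inj QsC); rewrite resP /= nuP.
have resM (g h : galQ) : res (g * h)%g = (res h * res g)%g.
  apply/eqP/gal_eqP => x _; apply: (fmorph_inj QsC).
  by rewrite galM ?memvf // !resP.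
exists (fun g => (res g)^-1%g); split=> [g h|g x|u].
- by rewrite resM invMg.
- by rewrite -resP -galM ?memvf // mulVg gal_id.
by have [g Dg] := res_onto u^-1%g; exists g; rewrite Dg invgK.
Qed.

(** Multiplying the minimal polynomials of the elements of [S] adds all their
    conjugates to [S], which makes the generated field normal. *)
Lemma rational_split_poly (S : seq algC) :
  exists (q : {poly rat}) (rs : seq algC),
    \prod_(r <- rs) ('X - r%:P) = map_poly ratr q /\ {subset S <= rs}.
Proof.
elim: S => [|x S [q [rs [Dq sSrs]]]].
  by exists 1, [::]; rewrite big_nil rmorph1.
have [m [Dm /monicP mon_m] _] := minCpolyP x.
have [r Dr] := closed_field_poly_normal (minCpoly x).
rewrite (monicP (minCpoly_monic x)) scale1r in Dr.
exists (m * q), (r ++ rs); split; first by rewrite big_cat /= -Dr Dq Dm rmorphM.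
move=> y; rewrite inE mem_cat => /predU1P[->|/sSrs->]; last exact: orbT.
by rewrite -root_prod_XsubC -Dr root_minCpoly.
Qed.

(** The fixed points of an automorphism form a field, so that fixing generators
    is enough. *)
Lemma mem_gal_gens (L : splittingFieldType rat) (s : seq L)
    (u : gal_of {:L}) :
  u \in 'Gal({:L} / <<1 & s>>)%g <-> {in s, u =1 id}.
Proof.
split=> [Ku x s_x|fix_s]; first by rewrite (fixed_gal _ Ku) ?subvf ?seqv_sub_adjoin.
rewrite gal_kHom ?subvf //; apply/kAHomP => x Kx; apply/fixedSpaceP.
apply: subvP Kx; apply/(@Fadjoin_seqP _ _ 1%AS _ (fixedSpace_aspace u)).
by split=> [|y s_y]; [exact: sub1v | apply/fixedSpaceP; exact: fix_s].
Qed.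

Lemma galQ_inj (g : galQ) : injective g.
Proof. by have [_ _ _ /bij_inj] := galP g. Qed.

Section FixedByRestriction.

Variables (L : splittingFieldType rat) (QsC : {rmorphism L -> algC}).
Variable res : galQ -> gal_of {:L}.
Hypothesis resC : forall (g : galQ) x, g (QsC (res g x)) = QsC x.

Lemma res_fix g s : {in s, res g =1 id} <-> {in map QsC s, g =1 id}.
Proof.
split=> [fix_s _ /mapP[x s_x ->]|fix_s x s_x].
  by rewrite -[in RHS](resC g) fix_s.
apply: (fmorph_inj QsC); apply: (@galQ_inj g).
by rewrite resC fix_s // map_f.
Qed.

Lemma res_eq1 g s : <<1 & s>>%VS = fullv ->
  res g = 1%g <-> {in map QsC s, g =1 id}.
Proof.
move=> gen_s; rewrite -res_fix; split=> [-> x _|]; first exact: gal_id.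
move/mem_gal_gens; rewrite gen_s => /fixed_gal fixL.
by apply/eqP/gal_eqP=> x Lx; rewrite gal_id fixL ?subvv.
Qed.

End FixedByRestriction.

(** The conjugates of [S] generate a normal number field [L] through whose Galois
    group [phi] factors.  The fixed field [M] in [L] of the kernel is normal over
    the rationals, and an automorphism of [algC] fixes [M] pointwise exactly when
    [phi] kills it; so restriction to [M] and [phi] have the same kernel. *)
Lemma finite_quotient_galois (gT : finGroupType) (phi : galQ -> gT)
    (S : seq algC) :
    hom_on (fun=> True) phi ->
    (forall g : galQ, {in S, g =1 id} -> phi g = 1%g) ->
  galois_group_over_Q (img (fun=> True) phi).
Proof.
move=> homphi phiS; have phi1 := hom_on1 (subgroup_predT _) homphi.
have phiV g : phi g^-1%g = (phi g)^-1%g by exact: (hom_onV (subgroup_predT _)).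
have phiM g h : phi (g * h)%g = (phi g * phi h)%g by exact: homphi.
have [q [rs [Dq sSrs]]] := rational_split_poly S.
have [L [QsC [s [Ds gen_s]]]] := normal_num_field Dq.
have [res [resM resC res_onto]] := galQ_restriction QsC.
have phi_res g : res g = 1%g -> phi g = 1%g.
  by move/(res_eq1 resC _ gen_s); rewrite Ds => fixrs; apply: phiS => x /sSrs/fixrs.
have kerS : subgroup_pred (fun g => phi g = 1%g).
  by split=> // [g h|g]; rewrite ?phiM ?phiV => ->; rewrite ?mul1g ?invg1.
have res_hom H : hom_on H res by move=> g h _ _; exact: resM.
pose K := Group (img_group_set kerS (res_hom _)).
have mem_K g : res g \in K <-> phi g = 1%g.
  split=> [/imgP[h phih /esym/(hom_on_eq (subgroup_predT _) (res_hom _))]|phig].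
    by move=> /(_ I I)/phi_res; rewrite phiM phiV phih invg1 mulg1.
  exact: mem_img.
have nKG : normal K 'Gal({:L} / 1%AS)%g.
  have GT : 'Gal({:L} / 1%AS)%g = [set: gal_of {:L}]%SET.
    by apply/setP => u; rewrite !inE gal_kHom ?sub1v // k1AHom.
  rewrite GT /normal finset.subsetT; apply/fintype.subsetP => u _; rewrite inE.
  apply/fintype.subsetP => _ /imsetP[v /imgP[g phig <-] ->].
  have [h <-] := res_onto u.
  rewrite conjgE -(hom_onV (subgroup_predT _) (res_hom _)) //.
  by rewrite -!resM mem_K !phiM phig mul1g -phiM mulVg.
(* M is the fixed field of K, and rs2 a Galois stable set of generators of M. *)
have galM := normal_fixedField_galois (galois_num_field L) nKG.
have [_ _] := and3P galM.
case/(splitting_normalField (sub1v _)) => p p1 [rs2 Dp gen_rs2].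
have [q2 Dq2] : exists q2, \prod_(r <- rs2) ('X - r%:P) = map_poly (in_alg L) q2.
  apply/polyOver1P.
  have [c nzc ->] : exists2 c, c \in 1%VS & \prod_(r <- rs2) ('X - r%:P) = c *: p.
    exists (lead_coef p)^-1; first by rewrite rpredV; exact: (polyOverP p1).
    have nzp : p != 0.
      rewrite -size_poly_eq0 (eqp_size Dp) size_poly_eq0.
      exact/monic_neq0/monic_prod_XsubC.
    have := eqp_eq Dp; rewrite (monicP (monic_prod_XsubC _ _ _)) scale1r => {2}->.
    by rewrite scalerA mulVf ?scale1r ?lead_coef_eq0.
  exact: polyOverZ.
have Dq2C : \prod_(r <- map QsC rs2) ('X - r%:P) = map_poly ratr q2.
  transitivity (map_poly QsC (\prod_(r <- rs2) ('X - r%:P))).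
    by rewrite rmorph_prod big_map; apply: eq_bigr => r _; rewrite /= map_polyXsubC.
  rewrite Dq2 -map_poly_comp; apply: eq_map_poly => a /=.
  by rewrite alg_num_field fmorph_rat.
(* L2 is a copy of M as a field extension of its own. *)
have [L2 [QsC2 [s2 [Ds2 gen_s2]]]] := normal_num_field Dq2C.
have [res2 [res2M res2C res2_onto]] := galQ_restriction QsC2.
have ker_res2 g : res2 g = 1%g <-> phi g = 1%g.
  rewrite (res_eq1 res2C _ gen_s2) Ds2 -(res_fix resC) -mem_gal_gens gen_rs2.
  by rewrite gal_fixedField.
have res2_hom : hom_on (fun=> True) res2 by move=> g h _ _; exact: res2M.
have [psi [isopsi _]] :=
  factor_isom (subgroup_predT _) res2_hom homphi (fun g _ => ker_res2 g).
exists L2; split; first exact: galois_num_field.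
have -> : 'Gal({:L2} / 1%VS)%g = img (fun=> True) res2.
  apply/setP => u; rewrite (gal_kHom _ (sub1v {:L2}%AS)) k1AHom.
  by have [g <-] := res2_onto u; rewrite mem_img.
pose F := Group (img_group_set (subgroup_predT _) res2_hom).
exact: (@isom_isog _ _ _ _ F (Morphism (morphM psi : {in F &, _}))).
Qed.

(** * Projective linear groups *)

Lemma GLval_inj (n : nat) (F : finFieldType) :
  injective (@GLval n F).
Proof. exact: val_inj. Qed.

Section ProjClass.

Variables (n : nat) (F : finFieldType).

Lemma GL_scalars_norm (x : {'GL_n.+1[F]}) : (x \in 'N(GL_scalars n F))%g.
Proof.
apply: (fintype.subsetP (cent_sub _)); apply/centP => y; rewrite inE.
case/is_scalar_mxP => a Dy; apply: GLval_inj; rewrite !GL_MxE Dy.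
exact: scalar_mxC.
Qed.

Lemma proj_class_GL (x : {'GL_n.+1[F]}) :
  proj_class (GLval x) = coset (GL_scalars n F) x.
Proof. by rewrite /proj_class valKd. Qed.

Lemma GL_of_unitmx (M : 'M[F]_n.+1) : M \in unitmx ->
  exists x : {'GL_n.+1[F]}, GLval x = M.
Proof. by move=> uM; exists (insubd (1 : {'GL_n.+1[F]})%g M); exact: insubdK. Qed.

Lemma proj_classM (M N : 'M[F]_n.+1) : M \in unitmx -> N \in unitmx ->
  proj_class (M *m N) = (proj_class M * proj_class N)%g.
Proof.
move=> /GL_of_unitmx[x <-] /GL_of_unitmx[y <-].
rewrite -[_ *m _]/(GLval (x * y)%g) !proj_class_GL.
by rewrite morphM ?GL_scalars_norm.
Qed.

Lemma coset_GL_eq1 (x : {'GL_n.+1[F]}) :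
  coset (GL_scalars n F) x = 1%g <-> is_scalar_mx (GLval x).
Proof.
have -> : is_scalar_mx (GLval x) = (x \in GL_scalars n F) by rewrite inE.
by split=> [/coset_idr-> //|/coset_id//]; exact: GL_scalars_norm.
Qed.

Lemma proj_class_eq1 (M : 'M[F]_n.+1) : M \in unitmx ->
  proj_class M = 1%g <-> is_scalar_mx M.
Proof.
by move=> /GL_of_unitmx[x <-]; rewrite proj_class_GL; exact: coset_GL_eq1.
Qed.

Lemma img_SL_coset : img (fun x => x \in SL n F) (coset (GL_scalars n F)) = PSL n F.
Proof.
apply/setP => y; apply/imgP/idP => [[x SLx <-]|/morphimP[x _ SLx ->]].
  by apply: mem_morphim; rewrite ?GL_scalars_norm.
by exists x.
Qed.

End ProjClass.

Lemma Fp_embedding (p : nat) (F : fieldType) : prime p -> p%:R = 0 :> F ->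
  exists io : {rmorphism 'F_p -> F}, forall a : 'F_p, io a = (a : nat)%:R.
Proof.
move=> p_pr p0; have chF : p \in [pchar F] by rewrite inE p_pr p0 eqxx.
pose io : {rmorphism 'F_p -> pPrimeCharType chF} := in_alg (pPrimeCharType chF).
exists (io : {rmorphism _ -> F}) => a.
exact: (mulr1 (a%:R : F)).
Qed.

(** A matrix over the prime field is scalar if and only if it is so over an
    extension, hence the reduction of SL_n+1(F_p) modulo scalars is the same group
    over both fields. *)
Lemma PSL_Fp_in_isom (n p : nat) (F : finFieldType) : prime p ->
    p%:R = 0 :> F ->
  exists kap : {morphism PSL_Fp_in n p F >-> coset_of (GL_scalars n 'F_p)},
    isom (PSL_Fp_in n p F) (PSL n 'F_p) kap.
Proof.
move=> p_pr p0; have [io ioE] := Fp_embedding p_pr p0.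
pose J (x : {'GL_n.+1['F_p]}) := @proj_class n F (map_mx io (GLval x)).
have uJ (x : {'GL_n.+1['F_p]}) : map_mx io (GLval x) \in unitmx.
  by rewrite map_unitmx GL_unitmx.
have JM (x y : {'GL_n.+1['F_p]}) : J (x * y)%g = (J x * J y)%g.
  by rewrite /J GL_MxE map_mxM proj_classM.
have -> : PSL_Fp_in n p F = img (fun x => x \in SL n 'F_p) J.
  have DJ (x : {'GL_n.+1['F_p]}) :
      @proj_class n F (map_mx (fun a : 'F_p => (a : nat)%:R : F) (GLval x)) = J x.
    by congr proj_class; apply/matrixP => i j; rewrite !mxE ioE.
  apply/setP => y; apply/imsetP/imgP => [[x SLx ->]|[x SLx <-]]; by exists x.
rewrite -(img_SL_coset n 'F_p).
have [||x y _ _|x _|kap [isok _]] := @factor_isom _ _ _ (fun x => x \in SL n 'F_p)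
    J (coset (GL_scalars n 'F_p)).
- by split=> [|g h|g]; [exact: group1|exact: groupM|rewrite groupV].
- by move=> x y _ _; exact: JM.
- by rewrite morphM ?GL_scalars_norm.
- apply: iff_trans (proj_class_eq1 (uJ x)) (iff_trans _ (iff_sym (coset_GL_eq1 x))).
  by rewrite (map_mx_is_scalar io).
by exists kap.
Qed.

Section Mx2.

Variable F : finFieldType.

Definition mx2 (a b c d : F) : 'M[F]_2 :=
  \matrix_(i, j) if i == 0 then (if j == 0 then a else b)
                 else (if j == 0 then c else d).

Lemma mx2_eta (M : 'M[F]_2) : M = mx2 (M 0 0) (M 0 1) (M 1 0) (M 1 1).
Proof.
apply/matrixP => i j; rewrite !mxE.
by case: i j => [[|[|i]] //= Hi] [[|[|j]] //= Hj]; congr (M _ _); apply: val_inj.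
Qed.

Lemma mx2M a b c d a' b' c' d' :
  mx2 a b c d *m mx2 a' b' c' d' =
  mx2 (a * a' + b * c') (a * b' + b * d') (c * a' + d * c') (c * b' + d * d').
Proof.
apply/matrixP => i j; rewrite !mxE !big_ord_recl big_ord0 addr0 !mxE /=.
by case: (i == 0); case: (j == 0).
Qed.

Lemma det_mx2 a b c d : \det (mx2 a b c d) = a * d - b * c.
Proof.
rewrite (expand_det_row _ 0) !big_ord_recl big_ord0 /cofactor !det_mx11 !mxE /=.
by rewrite expr0 expr1 mul1r mulN1r mulrN addr0.
Qed.

Lemma mx2_inj a b c d a' b' c' d' : mx2 a b c d = mx2 a' b' c' d' ->
  [/\ a = a', b = b', c = c' & d = d'].
Proof.
move/matrixP => E; have := (E 0 0, E 0 1, E 1 0, E 1 1).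
by rewrite !mxE /= => -[[[]]].
Qed.

Lemma scale_mx2 k a b c d : k *: mx2 a b c d = mx2 (k * a) (k * b) (k * c) (k * d).
Proof. by apply/matrixP => i j; rewrite !mxE; case: ifP; case: ifP. Qed.

Lemma SL_mx2 a b c d : a * d - b * c = 1 ->
  exists2 x : {'GL_2[F]}, x \in SL 1 F & GLval x = mx2 a b c d.
Proof.
move=> det1; have [|x Dx] := @GL_of_unitmx 1 F (mx2 a b c d).
  by rewrite unitmxE det_mx2 det1 unitr1.
by exists x => //; rewrite inE Dx [\det _]det_mx2 det1.
Qed.

(** Elementary matrices generate SL_2, and in odd characteristic each is the
    square of the elementary matrix with half its off-diagonal entry.  In
    particular SL_2 has no subgroup of index 2. *)
Lemma SL2_generated_by_squares (X : {group {'GL_2[F]}}) : 2%:R != 0 :> F ->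
  (forall x, x \in SL 1 F -> (x * x)%g \in X) -> SL 1 F \subset X.
Proof.
move=> nz2 sqX.
pose U a : {'GL_2[F]} := insubd (1 : {'GL_2[F]})%g (mx2 1 a 0 1).
pose W a : {'GL_2[F]} := insubd (1 : {'GL_2[F]})%g (mx2 1 0 a 1).
have UE a : GLval (U a) = mx2 1 a 0 1.
  by apply: insubdK; rewrite -topredE /= unitmxE det_mx2 mulr1 mulr0 subr0 unitr1.
have WE a : GLval (W a) = mx2 1 0 a 1.
  by apply: insubdK; rewrite -topredE /= unitmxE det_mx2 mulr1 mul0r subr0 unitr1.
have half (a : F) : a / 2%:R + a / 2%:R = a.
  by rewrite -mulr2n -[LHS]mulr_natr divfK.
have XU a : U a \in X.
  have -> : U a = (U (a / 2%:R)%R * U (a / 2%:R)%R)%g.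
    apply: GLval_inj; rewrite GL_MxE !UE [RHS]mx2M.
    by rewrite !(mulr0, mul0r, mulr1, mul1r, addr0, add0r) half.
  by apply: sqX; rewrite inE UE [\det _]det_mx2 mulr1 mulr0 subr0.
have XW a : W a \in X.
  have -> : W a = (W (a / 2%:R)%R * W (a / 2%:R)%R)%g.
    apply: GLval_inj; rewrite GL_MxE !WE [RHS]mx2M.
    by rewrite !(mulr0, mul0r, mulr1, mul1r, addr0, add0r) half.
  by apply: sqX; rewrite inE WE [\det _]det_mx2 mulr1 mul0r subr0.
(* A matrix whose lower left entry is invertible is U * W * U. *)
have Xc (x : {'GL_2[F]}) a b c d :
    GLval x = mx2 a b c d -> a * d - b * c = 1 -> c != 0 -> x \in X.
  move=> Dx det1 nzc.
  suff -> : x = (U ((a - 1) / c)%R * W c * U ((d - 1) / c)%R)%g by rewrite !groupM.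
  apply: GLval_inj; rewrite !GL_MxE UE WE UE Dx.
  rewrite [U in _ = U *m _]mx2M [RHS]mx2M.
  congr mx2; try by field.
  have -> : b = (a * d - 1) / c by rewrite -det1; field.
  by field.
apply/fintype.subsetP => x; rewrite inE => /eqP detx.
have Dx := mx2_eta (GLval x).
move: (GLval x 0 0) (GLval x 0 1) (GLval x 1 0) (GLval x 1 1) Dx => a b c d Dx.
rewrite Dx [\det _]det_mx2 in detx.
have [c0|nzc] := eqVneq c 0; last exact: Xc Dx detx nzc.
(* If c = 0 then a <> 0, and W 1 brings a into the lower left corner. *)
rewrite -(groupMl _ (XW 1)); apply: (Xc _ a b (a + c) (b + d)).
- rewrite GL_MxE WE Dx [LHS]mx2M; by congr mx2; ring.
- by rewrite -detx; ring.
rewrite c0 addr0; apply: contra_eqN detx => /eqP->.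
by rewrite c0 mul0r mulr0 subr0 eq_sym oner_eq0.
Qed.

(** A matrix that commutes up to a factor [k] with the upper and lower
    transvections is scalar: comparing the entries, a nonzero off-diagonal entry
    would force [k = 1], and then its own vanishing; once the matrix is diagonal,
    again [k = 1], and both diagonal entries agree.  This gives the triviality of
    the centers of PSL_2 and PGL_2 at once. *)
Lemma PSL2_centralizer (z : coset_of (GL_scalars 1 F)) :
    (forall y, y \in PSL 1 F -> (z * y)%g = (y * z)%g) -> z = 1%g.
Proof.
have [x _ ->] := cosetP z => comm_x; apply/coset_GL_eq1.
have comm (y : {'GL_2[F]}) : y \in SL 1 F ->
    exists k, GLval x *m GLval y = k *: (GLval y *m GLval x).
  move=> SLy; have := comm_x (coset _ y).
  rewrite -!morphM ?GL_scalars_norm // mem_morphim ?GL_scalars_norm // => /(_ isT).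
  move/eqP; rewrite eq_mulgV1 -morphV ?GL_scalars_norm //.
  rewrite -morphM ?GL_scalars_norm //.
  move/eqP/coset_GL_eq1/is_scalar_mxP => [k Dk]; exists k.
  by rewrite -!GL_MxE -mul_scalar_mx -Dk -GL_MxE mulgKV.
have Dx := mx2_eta (GLval x).
move: (GLval x 0 0) (GLval x 0 1) (GLval x 1 0) (GLval x 1 1) Dx => a b c d Dx.
have := GL_det x; rewrite Dx [\det _]det_mx2 => nzdet.
have c0 : c = 0.
  have [|y SLy Dy] := @SL_mx2 1 1 0 1; first by rewrite mulr1 mulr0 subr0.
  have [k] := comm y SLy.
  rewrite Dx Dy [_ *m _]mx2M [mx2 1 1 0 1 *m _]mx2M [RHS]scale_mx2.
  case/mx2_inj; rewrite !(mulr1, mulr0, mul1r, mul0r, addr0, add0r) => Ea _ Ec _.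
  have [//|nzc] := eqVneq c 0; move: Ea.
  have -> : k = 1 by apply: (mulIf nzc); rewrite mul1r -Ec.
  by rewrite mul1r -[LHS]addr0 => /addrI.
have b0 : b = 0.
  have [|y SLy Dy] := @SL_mx2 1 0 1 1; first by rewrite mulr1 mul0r subr0.
  have [k] := comm y SLy.
  rewrite Dx Dy [_ *m _]mx2M [mx2 1 0 1 1 *m _]mx2M [RHS]scale_mx2.
  case/mx2_inj; rewrite !(mulr1, mulr0, mul1r, mul0r, addr0, add0r) => Ea Eb _ _.
  have [//|nzb] := eqVneq b 0; move: Ea.
  have -> : k = 1 by apply: (mulIf nzb); rewrite mul1r -Eb.
  by rewrite mul1r -[RHS]addr0 => /addrI.
suff Ead : a = d.
  rewrite c0 b0 Ead.
  apply/is_scalar_mxP; exists d; apply/matrixP => i j; rewrite !mxE.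
  by case: i j => [[|[|i]] //= Hi] [[|[|j]] //= Hj].
have [|y SLy Dy] := @SL_mx2 1 1 0 1; first by rewrite mulr1 mulr0 subr0.
have [k] := comm y SLy.
rewrite Dx Dy [_ *m _]mx2M [mx2 1 1 0 1 *m _]mx2M [RHS]scale_mx2.
case/mx2_inj; rewrite b0 c0 !(mulr1, mulr0, mul1r, mul0r, addr0, add0r) => Ea Eb _ _.
have nza : a != 0.
  by apply: contraNneq nzdet => ->; rewrite b0 !mul0r subr0.
suff Dk : k = 1 by rewrite Dk mul1r in Eb.
by apply: (mulIf nza); rewrite mul1r -Ea.
Qed.

End Mx2.

(** * The matrix of the induced representation *)

Section InducedMatrix.

Variables (G : groupType) (F : fieldType) (m : nat).
Variables (H : G -> Prop) (pi : G -> 'M[F]_m) (s : G).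
Variable rho : G -> 'M[F]_(m + m).
Hypotheses (pi_rep : is_rep pi) (H_subgroup : subgroup_pred H).
Hypothesis s_repr : ~ H s /\ forall g, H g \/ H (g * s^-1)%g.
Hypothesis rho_ind : ind_matrix H pi s rho.

Let H1 : H 1%g. Proof. by case: H_subgroup. Qed.
Let HV g : H g -> H g^-1%g. Proof. by case: H_subgroup => _ _; apply. Qed.

Definition extend0 (g : G) : 'M[F]_m := if `[< H g >] then pi g else 0.

Lemma ind_basisE (j : 'I_(m + m)) x :
  ind_basis H pi s j x = col j (row_mx (extend0 x) (extend0 (x * s^-1)%g)).
Proof.
have phiE t i : ind_phi H pi t (delta_mx i 0) x = col i (extend0 (x * t^-1)%g).
  by rewrite /ind_phi /extend0 colE; case: ifP; rewrite ?mul0mx.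
rewrite /ind_basis -[j]splitK unsplitK.
case: (fintype.split j) => i; rewrite phiE /= ?invg1 ?mulg1.
  by rewrite colKl.
by rewrite colKr.
Qed.

(** The columns of [rho g] are the values at 1 and [s] of the translates by [g]
    of the basis functions, because a combination of the basis is read off
    from these two values. *)
Lemma ind_matrixE g :
  rho g = block_mx (extend0 g) (extend0 (g * s^-1)%g)
                   (extend0 (s * g)%g) (extend0 (s * g * s^-1)%g).
Proof.
have up j i : rho g (lshift m i) j =
    row_mx (extend0 g) (extend0 (g * s^-1)%g) i j.
  have := rho_ind g j 1%g; rewrite (ind_comb_at1 pi_rep H1 HV s_repr) /ind_act mul1g.
  by rewrite ind_basisE => /colP/(_ i); rewrite !mxE.
have down j i : rho g (rshift m i) j =
    row_mx (extend0 (s * g)%g) (extend0 (s * g * s^-1)%g) i j.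
  have := rho_ind g j s; rewrite (ind_comb_ats pi_rep H1 s_repr) /ind_act.
  by rewrite ind_basisE => /colP/(_ i); rewrite !mxE.
apply/matrixP => i j; case: (split_ordP i) => k ->.
  by rewrite up /block_mx col_mxEu.
by rewrite down /block_mx col_mxEd.
Qed.

Lemma ind_matrix_rep : is_rep rho.
Proof.
split.
  rewrite ind_matrixE mulg1 mul1g mulgV /extend0 asboolT // asboolF; last first.
    by move/HV; rewrite invgK; exact: s_repr.1.
  by rewrite asboolF ?(pi_rep.1) -?scalar_mx_block //; exact: s_repr.1.
move=> g h; apply/matrixP => i j; rewrite !mxE.
apply/eqP; rewrite -subr_eq0; apply/eqP.
move: i; apply: (ind_basis_free pi_rep H1 HV s_repr) => x.
under eq_bigr do rewrite scalerBl.
rewrite sumrB -(rho_ind (g * h)%g j x) /ind_act mulgA.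
have -> : ind_basis H pi s j (x * g * h)%g =
  \sum_i rho h i j *: ind_basis H pi s i (x * g)%g.
  exact: (rho_ind h j (x * g)%g).
have step i : ind_basis H pi s i (x * g)%g =
    \sum_k rho g k i *: ind_basis H pi s k x.
  exact: (rho_ind g i x).
under eq_bigr do rewrite step scaler_sumr.
rewrite exchange_big /= -sumrB; apply: big1 => k _.
rewrite scaler_suml -sumrB; apply: big1 => i _.
by rewrite scalerA mulrC subrr.
Qed.

End InducedMatrix.

(** * Reduction modulo the prime *)

Section Reduction.

Variables (E : fieldExtType rat) (Lambda : E -> Prop) (K : fieldType).
Variables (iota : {rmorphism E -> K}) (v : K -> int).
Variables (k : finFieldType) (red : K -> k).
Hypotheses (K_completion : is_completion Lambda iota v).
Hypotheses (k_residue : is_residue_map v red).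

Lemma red0 : red 0 = 0.
Proof.
have v0 : val_ring v 0 by left.
by apply: (addrI (red 0)); rewrite -(red_D k_residue) // !addr0.
Qed.

Lemma val_ring1 : val_ring v 1.
Proof.
right; have := cpl_mul K_completion (oner_neq0 K) (oner_neq0 K).
by rewrite mulr1 => /eqP; rewrite -subr_eq subrr => /eqP<-.
Qed.

Lemma val_ringM x y : val_ring v x -> val_ring v y -> val_ring v (x * y).
Proof.
have [->|nzx] := eqVneq x 0; first by rewrite mul0r.
have [->|nzy] := eqVneq y 0; first by rewrite mulr0.
move=> [/eqP|vx]; first by rewrite (negPf nzx).
move=> [/eqP|vy]; first by rewrite (negPf nzy).
by right; rewrite (cpl_mul K_completion) // addr_ge0.
Qed.

Lemma val_ringD x y : val_ring v x -> val_ring v y -> val_ring v (x + y).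
Proof. exact: (@cpl_add _ _ _ _ _ K_completion 0). Qed.

Lemma red_sum (I : Type) (r : seq I) (F : I -> K) :
    (forall i, val_ring v (F i)) ->
  val_ring v (\sum_(i <- r) F i) /\
  red (\sum_(i <- r) F i) = \sum_(i <- r) red (F i).
Proof.
move=> vF; elim: r => [|i r [vr Dr]].
  by rewrite !big_nil red0; split; first by left.
by rewrite !big_cons (red_D k_residue) // Dr; split; first exact: val_ringD.
Qed.

Lemma map_red_mulmx n (A B : 'M[K]_n) : mx_integral v A -> mx_integral v B ->
  map_mx red (A *m B) = map_mx red A *m map_mx red B.
Proof.
move=> vA vB; apply/matrixP => i j; rewrite !mxE.
have [|_ ->] := @red_sum _ (index_enum 'I_n) (fun l => A i l * B l j).
  by move=> l; exact: val_ringM.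
by apply: eq_bigr => l _; rewrite !mxE (red_M k_residue).
Qed.

Lemma map_red1 n : map_mx red (1%:M : 'M[K]_n) = 1%:M.
Proof.
apply/matrixP => i j; rewrite !mxE.
by case: (i == j); rewrite /= ?red0 ?(red_1 k_residue).
Qed.

(** This turns the continuity of a representation at 1 into the triviality of
    its reduction on an open subgroup. *)
Lemma map_red_near1 n (A : 'M[K]_n) :
  (forall i j, val_ge v 1 (A i j - (1%:M : 'M[K]_n) i j)) -> map_mx red A = 1%:M.
Proof.
move=> nearA; rewrite -(map_red1 n); apply/matrixP => i j; rewrite !mxE.
have := nearA i j; rewrite !mxE; set x := A i j; set y := _ *+ _ => ge1.
have v0 : val_ring v (x - y).
  by case: ge1 => [?|le1]; [left | right; exact: (le_trans _ le1)].
have vy : val_ring v y.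
  by rewrite /y; case: (i == j); [exact: val_ring1 | left].
by rewrite -(subrK y x) (red_D k_residue) // ((red_ker k_residue v0).2 ge1) add0r.
Qed.

Lemma red_natr p : Lambda p%:R -> p%:R = 0 :> k.
Proof.
move=> Lp; have intE (n : nat) : ring_of_integers (n%:R : E).
  rewrite -[n%:R](rmorph_nat (intr : {rmorphism int -> E})).
  exact: integral_id.
have vn (n : nat) : val_ring v n%:R /\ red n%:R = n%:R.
  elim: n => [|n [vn Dn]]; first by rewrite red0; split; first by left.
  have v1 := val_ring1.
  rewrite -addn1 !natrD (red_D k_residue) // Dn (red_1 k_residue).
  by split; first exact: val_ringD.
have [vp <-] := vn p; apply/(red_ker k_residue vp).
have /(cpl_ext K_completion 1)[_] := intE p; rewrite rmorph_nat; apply.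
exists [:: (p%:R, 1)]; rewrite big_seq1 mulr1; split=> // u.
rewrite inE => /eqP-> /=.
by split=> //; exact: (intE 1%N).
Qed.

Section ReducedRep.

Variables (G : groupType) (n : nat) (r : G -> 'M[K]_n.+1).
Hypotheses (r_rep : is_rep r) (r_int : forall g, mx_integral v (r g)).

Lemma reduced_repM g h :
  map_mx red (r (g * h)%g) = map_mx red (r g) *m map_mx red (r h).
Proof. by rewrite (r_rep.2) map_red_mulmx. Qed.

Lemma reduced_repV g : map_mx red (r g) *m map_mx red (r g^-1%g) = 1%:M.
Proof. by rewrite -reduced_repM mulgV r_rep.1 map_red1. Qed.

Lemma reduced_rep_unit g : map_mx red (r g) \in unitmx.
Proof. by have [] := mulmx1_unit (reduced_repV g). Qed.

Lemma reduced_rep_hom H : hom_on H (fun g => proj_class (map_mx red (r g))).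
Proof. by move=> g h _ _; rewrite reduced_repM proj_classM ?reduced_rep_unit. Qed.

End ReducedRep.

Section ReducedInduced.

Variables (G : groupType) (n : nat) (H : G -> Prop) (s : G).
Variables (pi : G -> 'M[K]_n.+1) (rho : G -> 'M[K]_(n.+1 + n.+1)).
Hypotheses (pi_rep : is_rep pi) (pi_int : forall g, mx_integral v (pi g)).
Hypothesis H_subgroup : subgroup_pred H.
Hypothesis s_repr : ~ H s /\ forall g, H g \/ H (g * s^-1)%g.
Hypothesis H_conj : forall g, H g -> H (s * g * s^-1)%g.
Hypothesis rho_ind : ind_matrix H pi s rho.

Lemma induced_integral g : mx_integral v (rho g).
Proof.
have ext_int x i j : val_ring v (extend0 H pi x i j).
  by rewrite /extend0; case: ifP => _; [exact: pi_int | rewrite mxE; left].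
rewrite (ind_matrixE pi_rep H_subgroup s_repr rho_ind) => i j.
rewrite mxE; case: (fintype.split i) => i'; rewrite mxE.
  by case: (fintype.split j) => j'; exact: ext_int.
by case: (fintype.split j) => j'; exact: ext_int.
Qed.

(** Outside [H] the upper left block vanishes, and a scalar matrix with this
    property is zero, hence singular.  On [H] the matrix is block diagonal and its
    two blocks are conjugate, so that one is scalar if and only if both are, with
    the same eigenvalue. *)
Lemma map_red_induced_scalar g :
  is_scalar_mx (map_mx red (rho g)) <-> H g /\ is_scalar_mx (map_mx red (pi g)).
Proof.
have rho_rep := ind_matrix_rep pi_rep H_subgroup s_repr rho_ind.
have [_ HM HV] := H_subgroup.
have map_red0 p q : map_mx red (0 : 'M[K]_(p, q)) = 0.
  by apply/matrixP => i j; rewrite !mxE red0.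
have Drho := ind_matrixE pi_rep H_subgroup s_repr rho_ind g.
have [Hg|nHg] := pselect (H g); last first.
  split=> [/is_scalar_mxP[a Da]|[]//]; case/negP: (negbT (erefl false)).
  have := Da; rewrite Drho map_block_mx (scalar_mx_block n.+1 n.+1).
  case/eq_block_mx; rewrite /extend0 asboolF // map_red0.
  move=> /matrixP/(_ 0 0); rewrite !mxE /= => a0 _ _ _.
  have := @reduced_rep_unit G _ rho rho_rep induced_integral g.
  by rewrite Da -[a]a0 raddf0 unitmxE det0 unitr0.
have nHsg : ~ H (s * g)%g.
  by move=> /HM/(_ (HV _ Hg)); rewrite mulgK; exact: s_repr.1.
have nHgs : ~ H (g * s^-1)%g.
  move=> /(HM _ _ (HV _ Hg)); rewrite mulKg => /HV; rewrite invgK; exact: s_repr.1.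
rewrite Drho /extend0 (asboolT Hg) (asboolF nHgs) (asboolF nHsg).
rewrite (asboolT (H_conj Hg)) map_block_mx !map_red0.
split=> [/is_scalar_mxP[a]|[_ /is_scalar_mxP[a Da]]].
  rewrite (scalar_mx_block n.+1 n.+1) => /eq_block_mx[-> _ _ _].
  by split=> //; exact: scalar_mx_is_scalar.
apply/is_scalar_mxP; exists a; rewrite (scalar_mx_block n.+1 n.+1) -Da.
rewrite !(reduced_repM pi_rep pi_int) Da mul_mx_scalar -scalemxAl.
by rewrite (reduced_repV pi_rep pi_int) scalemx1.
Qed.

Lemma reduced_induced_eq1 g :
  @proj_class (n + n.+1) k (map_mx red (rho g)) = 1%g <->
  H g /\ proj_class (map_mx red (pi g)) = 1%g.
Proof.
have rho_rep := ind_matrix_rep pi_rep H_subgroup s_repr rho_ind.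
apply: iff_trans (proj_class_eq1 _) _.
  exact: (@reduced_rep_unit G (n + n.+1) rho rho_rep induced_integral g).
apply: iff_trans (map_red_induced_scalar g) _.
have := proj_class_eq1 (reduced_rep_unit pi_rep pi_int g).
by move=> e; split=> -[Hg /e].
Qed.

End ReducedInduced.
End Reduction.

(** * Semidirect products by an inner involution *)

Lemma inner_involution_action (aT : finGroupType) (P : {group aT}) (c : aT) :
    c \in P -> (c * c)%g = 1%g ->
  exists act : groupAction [set: 'Z_2]%G P,
    forall x (z : 'Z_2), x \in P -> act x z = (x ^ (c ^+ z))%g.
Proof.
move=> Pc cc1.
pose to x (z : 'Z_2) := if x \in P then (x ^ (c ^+ z))%g else x.
have toP x z : (to x z \in P) = (x \in P).
  by rewrite /to; case: ifP => // Px; rewrite groupJ ?groupX.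
have cX (z w : 'Z_2) : (c ^+ (z * w)%g = c ^+ z * c ^+ w)%g.
  by rewrite -expgD /=; apply: expg_mod; rewrite expgS expg1.
have to1 : to^~ 1%g =1 id by move=> x; rewrite /to expg0 conjg1 if_same.
have toM x : act_morph to x.
  move=> z w; rewrite {1}/to {1}/to toP; case: ifP => Px; rewrite /to Px //.
  by rewrite cX conjgM.
have to_aut : is_groupAction P (TotalAction to1 toM).
  move=> z _; rewrite inE; apply/andP; split.
    apply/fintype.subsetP => x; rewrite inE actpermE /= /to.
    by case: ifP => // _; rewrite eqxx.
  apply/morphicP => x y Px Py; rewrite !actpermE /= /to Px Py groupM //.
  exact: conjMg.
exists (GroupAction to_aut) => x z Px /=.
by rewrite /to Px.
Qed.

Section InnerSemidirect.

Variables (G : groupType) (H : G -> Prop) (eps : G -> bool) (s : G).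
Hypothesis HE : H = (fun g => ~~ eps g).
Variables (aT rT : finGroupType) (P : {group aT}) (q : G -> aT) (f : G -> rT).
Hypothesis epsM : forall g h, eps (g * h)%g = eps g (+) eps h.
Hypotheses (eps_s : eps s) (ss1 : (s * s)%g = 1%g).
Hypothesis q_hom : forall g h, q (g * h)%g = (q g * q h)%g.
Hypothesis f_hom : forall g h, f (g * h)%g = (f g * f h)%g.
Hypothesis qP : forall g, q g \in P.
Hypothesis q_onto : forall y, y \in P -> exists2 h, H h & q h = y.
Hypothesis f_eq1 : forall g, f g = 1%g <-> H g /\ q g = 1%g.
Hypothesis P_center : forall z, (forall y, y \in P -> (z * y = y * z)%g) -> z = 1%g.

Let c := q s.

Let eps1 : eps 1%g = false.
Proof. by have := epsM s s; rewrite ss1 eps_s. Qed.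

Let epsV g : eps g^-1%g = eps g.
Proof.
by have := epsM g g^-1%g; rewrite mulgV eps1; case: (eps g); case: (eps _).
Qed.

Let H_subgroup : subgroup_pred H.
Proof.
rewrite HE; split=> [|g h|g]; first by rewrite eps1.
  by rewrite epsM => /negPf-> /negPf->.
by rewrite epsV.
Qed.

Let q_homT : hom_on (fun=> True) q. Proof. by move=> g h _ _. Qed.
Let f_homT : hom_on (fun=> True) f. Proof. by move=> g h _ _. Qed.
Let q1 : q 1%g = 1%g. Proof. exact: hom_on1 (subgroup_predT _) q_homT. Qed.
Let f1 : f 1%g = 1%g. Proof. exact: hom_on1 (subgroup_predT _) f_homT. Qed.
Let qV g : q g^-1%g = (q g)^-1%g.
Proof. exact: (hom_onV (subgroup_predT _) q_homT). Qed.
Let fV g : f g^-1%g = (f g)^-1%g.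
Proof. exact: (hom_onV (subgroup_predT _) f_homT). Qed.

Let cc1 : (c * c)%g = 1%g. Proof. by rewrite -q_hom ss1. Qed.
Let ss1f : (f s * f s)%g = 1%g. Proof. by rewrite -f_hom ss1. Qed.
Let cV : (c^-1)%g = c. Proof. by apply: (mulgI c); rewrite mulgV cc1. Qed.

(** On [H] the maps [q] and [f] have the same kernel, so an element [h0] of [H]
    with [q h0 = q s] acts on the image of [H] as [s] does. *)
Lemma f_conj_inner : f s \in 'N(img H f)%g /\
  exists2 b, b \in img H f & forall x, x \in img H f ->
    (f s * x * (f s)^-1)%g = (b * x * b^-1)%g.
Proof.
have [h0 Hh0 qh0] := q_onto (qP s).
have inner x : x \in img H f ->
    (f s * x * (f s)^-1)%g = (f h0 * x * (f h0)^-1)%g.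
  move=> /imgP[h Hh <-]; rewrite -!fV -!f_hom.
  apply/(hom_on_eq (subgroup_predT _) f_homT) => //; apply/f_eq1.
  rewrite HE !epsM !epsV !epsM !epsV !q_hom !qV !q_hom !qV qh0 mulgV; split=> //.
  by case: (eps s); case: (eps h); case: (eps h0).
split; last by exists (f h0); first exact: mem_img.
pose N := Group (img_group_set H_subgroup (fun g h _ _ => f_hom g h)).
rewrite inE; apply/fintype.subsetP => _ /imsetP[x Nx ->].
have sVf : (f s)^-1%g = f s by apply: (mulgI (f s)); rewrite mulgV ss1f.
have Nh0 : f h0 \in N by exact: mem_img.
have -> : (x ^ f s = f s * x * (f s)^-1)%g by rewrite conjgE mulgA !sVf.
rewrite inner // -[_ \in _]/(_ \in N).
by rewrite groupMr ?groupV // groupMl.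
Qed.

(** In the semidirect product, [zeta], the product of the generator of the
    complement with [q s], acts on the normal factor by conjugation by [(q s)^2 = 1].
    So it is a central involution, and [g |-> zeta ^+ eps g * q g] is a
    homomorphism [theta].  It is onto, sends [s] to the generator of the
    complement and has the kernel of [f]; the isomorphism [Phi] is [theta]
    factored through [f].  The map [theta] itself is kept in the conclusion since
    it has values in the semidirect product, which is to be realized as a Galois
    group. *)
Lemma semidirect_structure :
  exists (psi : {morphism img H f >-> aT})
         (act : groupAction [set: 'Z_2]%G P) (theta : G -> sdprod_by act)
         (Phi : {morphism img (fun=> True) f >-> sdprod_by act}),
  [/\ [/\ isom (img H f) P psi,
          forall x, x \in img H f ->
            act (psi x) (1%R : 'Z_2) = psi (f s * x * (f s)^-1)%g &
          (forall (z : 'Z_2) x, x \in P -> act x z = x) <-> q s = 1%g],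
      [/\ isom (img (fun=> True) f) [set: sdprod_by act]%SET Phi,
          forall g, (pair_of_sd (Phi (f g))).1 = (0%R : 'Z_2) <-> H g,
          forall h, H h -> Phi (f h) = sdpair1 act (psi (f h)) &
          Phi (f s) = sdpair2 act (1%R : 'Z_2)],
      [/\ hom_on (fun=> True) theta, forall g, theta g = 1%g <-> f g = 1%g &
          img (fun=> True) theta = [set: sdprod_by act]%SET] &
      exists2 zeta : sdprod_by act,
        zeta \in 'Z([set: sdprod_by act]%SET)%g & zeta != 1%g].
Proof.
have Pc : c \in P by exact: qP.
have [act actE] := inner_involution_action Pc cc1.
have f_homH : hom_on H f by move=> g h _ _.
have q_homH : hom_on H q by move=> g h _ _.
have kerH x : H x -> f x = 1%g <-> q x = 1%g.
  by move=> Hx; split=> [/f_eq1[]|qx]; last exact/f_eq1.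
have [psi [isopsi psiE]] := factor_isom H_subgroup f_homH q_homH kerH.
have imgHq : img H q = P.
  apply/setP => y; apply/imgP/idP => [[h _ <-]|/q_onto[h Hh <-]]; first exact: qP.
  by exists h.
have act1 x : x \in P -> act x (1%R : 'Z_2) = (x ^ c)%g.
  by move=> Px; rewrite actE.
pose a1 := sdpair1 act; pose a2 := sdpair2 act (1%R : 'Z_2).
have Z2T z : z \in [set: 'Z_2]%G by rewrite inE.
have a1J x : x \in P -> (a1 x ^ a2 = a1 (x ^ c))%g.
  by move=> Px; rewrite /a1 /a2 -sdpair_act ?act1.
have a1M x y : x \in P -> y \in P -> a1 (x * y)%g = (a1 x * a1 y)%g.
  by move=> Px Py; rewrite /a1 morphM.
have a22 : (a2 * a2)%g = 1%g.
  rewrite /a2 -morphM // -[RHS](morph1 (sdpair2_morphism act)); congr (sdpair2 _ _).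
  exact: val_inj.
pose zeta := (a2 * a1 c)%g.
have comm_ac : commute a2 (a1 c).
  by apply/commute_sym/commgP/conjg_fixP; rewrite a1J // /conjg mulKg.
have zeta2 : (zeta * zeta)%g = 1%g.
  rewrite /zeta mulgA -(mulgA a2) -comm_ac mulgA a22 mul1g -a1M // cc1.
  exact: morph1.
have zeta_a1 x : x \in P -> commute zeta (a1 x).
  move=> Px; apply/commute_sym/commgP/conjg_fixP; rewrite /zeta conjgM a1J //.
  rewrite /a1 -morphJ ?groupJ // -conjgM cc1 conjg1; done.
have zeta_a2 : commute zeta a2.
  by apply/commute_sym/commuteM; first exact: commute_refl.
have sd_gen (u : sdprod_by act) :
    u = (a2 ^+ (pair_of_sd u).1 * a1 (pair_of_sd u).2)%g.
  rewrite [LHS]sdpairE /a2 -morphX //; congr (sdpair2 _ _ * _)%g.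
  apply: val_inj; case: (u.1) => [[|[|i]] Hi] //=.
have sd2P (u : sdprod_by act) : (pair_of_sd u).2 \in P.
  by case: u => -[z x] /= /setXP[].
have zetaZ : zeta \in 'Z([set: sdprod_by act]%SET)%g.
  apply/centerP; split; first by rewrite inE.
  move=> u _; rewrite [u]sd_gen; apply: commuteM; last exact: zeta_a1.
  exact: commuteX.
have fst_zeta : (pair_of_sd zeta).1 = (1%R : 'Z_2).
  rewrite /zeta /a2 /a1 /= !val_insubd !inE !group1 Pc /=.
  exact: mulg1.
pose theta g := (zeta ^+ eps g * a1 (q g))%g.
have zetaX b b' : (zeta ^+ (b (+) b') = zeta ^+ b * zeta ^+ b')%g.
  by case: b b' => [] []; rewrite /= ?expg0 ?expg1 ?mulg1 ?mul1g ?zeta2.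
have theta_hom : hom_on (fun=> True) theta.
  move=> g h _ _; rewrite /theta epsM zetaX q_hom a1M // -!mulgA; congr (_ * _)%g.
  rewrite !mulgA; congr (_ * _)%g.
  exact/commute_sym/commuteX/commute_sym/zeta_a1.
have fst_a1 x : (pair_of_sd (a1 x)).1 = 1%g.
  by rewrite /a1 /= val_insubd; case: ifP.
have fst_theta g : ((pair_of_sd (theta g)).1 == (0%R : 'Z_2)) = ~~ eps g.
  have -> : (pair_of_sd (theta g)).1 = ((pair_of_sd (zeta ^+ eps g)).1 * 1)%g.
    by rewrite -[in RHS](fst_a1 (q g)).
  by rewrite mulg1; case: (eps g); rewrite // expg1 fst_zeta.
have theta_H g : H g -> theta g = a1 (q g).
  by rewrite HE => /negPf Hg; rewrite /theta Hg expg0 mul1g.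
have theta_s : theta s = a2.
  by rewrite /theta eps_s expg1 /zeta -mulgA -a1M // cc1 [a1 _]morph1 mulg1.
have theta_eq1 g : theta g = 1%g <-> f g = 1%g.
  split=> [th1|/f_eq1[Hg qg]]; last by rewrite theta_H // qg [a1 _]morph1.
  have Hg : H g by rewrite HE -fst_theta th1.
  apply/f_eq1; split=> //; move: th1; rewrite theta_H //.
  by move/eqP; rewrite /a1 (morph_injm_eq1 (injm_sdpair1 act)) ?qP // => /eqP.
have imgT_theta : img (fun=> True) theta = [set: sdprod_by act]%SET.
  apply/setP => u; rewrite finset.in_setT; apply/imgP.
  have [h Hh qh] := q_onto (sd2P u); have Du := sd_gen u.
  have [z0|z1] : (pair_of_sd u).1 = (0%R : 'Z_2) \/ (pair_of_sd u).1 = (1%R : 'Z_2).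
    by case: (pair_of_sd u).1 => [[|[|i]] Hi] //; [left|right]; exact: val_inj.
    by exists h => //; rewrite [RHS]Du theta_H // qh z0 expg0 mul1g.
  exists (s * h)%g => //; rewrite [RHS]Du theta_hom // theta_s theta_H // qh z1.
  by rewrite expg1.
have [Phi [isoPhi PhiE]] := factor_isom (subgroup_predT _) f_homT theta_hom
  (fun g _ => iff_sym (theta_eq1 g)).
rewrite imgT_theta in isoPhi; rewrite imgHq in isopsi.
exists psi, act, theta, Phi; split; [split=> // | split=> // | by split |].
- move=> _ /imgP[h Hh <-].
  have Hshs : H (s * h * s^-1)%g.
    by move: Hh; rewrite HE !epsM epsV addbC addbA addbb.
  rewrite psiE // act1 // -fV -!f_hom psiE // !q_hom qV -/c cV.
  by rewrite conjgE cV mulgA.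
- split=> [triv|c1 z x Px]; last by rewrite actE // -[c]/(q s) c1 expg1n conjg1.
  apply: P_center => y Py; apply/esym/commgP/conjg_fixP.
  by rewrite -[RHS](triv (1%R : 'Z_2)) // act1.
- by move=> g; rewrite PhiE // HE -fst_theta; split=> /eqP.
- by move=> h Hh; rewrite PhiE // theta_H // psiE.
- by rewrite PhiE.
exists zeta => //; apply/eqP => z1; have := fst_zeta; rewrite z1.
by move/(congr1 val).
Qed.

End InnerSemidirect.

(** * Complex conjugation and the Gaussian rationals *)

Lemma galQ_i (g : galQ) : g 'i = 'i \/ g 'i = - 'i.
Proof.
have [nu Dnu] := galQ_rmorphism g; rewrite -Dnu.
have /eqP : nu 'i ^+ 2 = 'i ^+ 2 by rewrite -rmorphXn sqrCi rmorphN1.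
by rewrite eqf_sqr => /orP[]/eqP; [left | right].
Qed.

Lemma opp_i_neq : - 'i != 'i :> algC.
Proof. by rewrite eq_sym -subr_eq0 opprK -mulr2n mulrn_eq0 /= neq0Ci. Qed.

Definition moves_i (g : galQ) : bool := g 'i != 'i.

Lemma gal_over_QiE : gal_over_Qi = (fun g => ~~ moves_i g).
Proof.
apply/funext => g; rewrite /moves_i negbK; apply/propext; split=> [fixQi|/eqP fixi].
  by apply/eqP/fixQi; exists 0, 1; rewrite rmorph0 rmorph1 mul1r add0r.
have [nu Dnu] := galQ_rmorphism g.
move=> _ [a [b ->]]; rewrite -Dnu rmorphD (rmorphM nu (ratr b)).
by rewrite !(fmorph_rat nu) Dnu fixi.
Qed.

Lemma moves_iM (g h : galQ) : moves_i (g * h)%g = moves_i g (+) moves_i h.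
Proof.
have gN x : g (- x) = - g x.
  by have [nu Dnu] := galQ_rmorphism g; rewrite -!Dnu rmorphN.
rewrite /moves_i -[(g * h)%g 'i]/(g (h 'i)).
have ni := negPf opp_i_neq.
by case: (galQ_i g) (galQ_i h) => Dg [] Dh; rewrite Dh ?gN Dg ?opprK ?eqxx ?ni.
Qed.

Lemma moves_i_conj : moves_i complex_conj.
Proof. by rewrite /moves_i /= conjCi opp_i_neq. Qed.

Lemma complex_conj2 : (complex_conj * complex_conj)%g = 1%g.
Proof. by apply: galQ_ext => x; exact: conjCK. Qed.

Lemma moves_i1 : moves_i 1%g = false.
Proof. by have := moves_iM 1%g 1%g; rewrite mulg1; case: (moves_i _). Qed.

Lemma moves_iV (g : galQ) : moves_i g^-1%g = moves_i g.
Proof.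
have := moves_iM g g^-1%g; rewrite mulgV moves_i1.
by case: (moves_i g); case: (moves_i _).
Qed.

Lemma gal_over_Qi_subgroup : subgroup_pred gal_over_Qi.
Proof.
rewrite gal_over_QiE; split=> [|g h|g]; first by rewrite moves_i1.
  by rewrite moves_iM => /negPf-> /negPf->.
by rewrite moves_iV.
Qed.

Lemma gal_over_Qi_index2 : ~ gal_over_Qi complex_conj /\
  forall g, gal_over_Qi g \/ gal_over_Qi (g * complex_conj^-1)%g.
Proof.
rewrite gal_over_QiE; split=> [|g]; first by rewrite moves_i_conj.
rewrite moves_iM moves_iV moves_i_conj.
by case: (moves_i g); [right | left].
Qed.

Lemma PGL2_center (F : finFieldType) : 'Z(PGL 1 F)%g = 1%g.
Proof.
apply/trivgP/fintype.subsetP => z /centerP[_ cz]; rewrite inE; apply/eqP.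
apply: PSL2_centralizer => y PSLy; apply: cz.
by apply: (fintype.subsetP (quotientS _ (finset.subsetT (SL 1 F)))).
Qed.

(** * The projective image of the induced representation *)

Theorem theorem3p12
  (p : nat) (p_prime : prime p) (p_ge5 : (5 <= p)%N)
  (* the non-CM newform f *)
  (R : realType) (k N : nat) (k_gt1 : (1 < k)%N) (N_gt0 : (0 < N)%N)
  (eps : int -> complex R) (a : nat -> complex R)
  (f : complex R -> complex R)
  (f_newform : newform k N eps a f) (f_nonCM : ~ has_CM N a)
  (* the number field E, its prime Lambda above p, completion, residue field *)
  (E : fieldExtType rat) (tau : {rmorphism E -> complex R})
  (E_coefs : forall n : nat, exists x : E, tau x = a n)
  (Lambda : E -> Prop)
  (Lambda_prime : prime_ideal (@ring_of_integers E) Lambda)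
  (Lambda_p : Lambda p%:R)
  (EL : fieldType) (iota : {rmorphism E -> EL}) (v : EL -> int)
  (EL_completion : is_completion Lambda iota v)
  (FL : finFieldType) (red : EL -> FL) (FL_residue : is_residue_map v red)
  (* the representation pi *)
  (pi : galQ -> 'M[EL]_2)
  (pi_attached : attached_rep tau iota v k N p eps a pi)
  (pi_integral : forall g : galQ, mx_integral v (pi g))
  (pi_image : img (fun _ : galQ => True)
                (fun g => @proj_class 1 FL (map_mx red (pi g)))
              = PSL_Fp_in 1 p FL)
  (* the induced representation rho *)
  (rho : galQ -> 'M[EL]_(2 + 2))
  (rho_ind : ind_matrix gal_over_Qi pi complex_conj rho) :
  let s := complex_conj in
  let pit := fun g : galQ => @proj_class 1 FL (map_mx red (pi g)) in
  let rhot := fun g : galQ => @proj_class 3 FL (map_mx red (rho g)) in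
  let rhotG := img (fun _ : galQ => True) rhot in
  let rhotH := img gal_over_Qi rhot in
  exists (psi : {morphism rhotH >-> coset_of (GL_scalars 1 'F_p)})
         (act : groupAction [set: 'Z_2]%G (PSL 1 'F_p)),
  [/\ (* (1) *)
      [/\ isom rhotH (PSL 1 'F_p) psi,
          forall x, x \in rhotH ->
            act (psi x) (1%R : 'Z_2) = psi (rhot s * x * (rhot s)^-1)%g,
          exists Phi : {morphism rhotG >-> sdprod_by act},
            [/\ isom rhotG [set: sdprod_by act]%SET Phi,
                forall g, (pair_of_sd (Phi (rhot g))).1 = (0%R : 'Z_2) <->
                          gal_over_Qi g,
                forall h, gal_over_Qi h ->
                  Phi (rhot h) = sdpair1 act (psi (rhot h)) &
                Phi (rhot s) = sdpair2 act (1%R : 'Z_2)] &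
          galois_group_over_Q [set: sdprod_by act]%SET],
      (* (2) *)
      (forall (z : 'Z_2) x, x \in PSL 1 'F_p -> act x z = x) <->
        pit s = 1%g,
      (* (3) *)
      rhot s \in 'N(rhotH)%g /\
        (exists2 b, b \in rhotH & forall x, x \in rhotH ->
           (rhot s * x * (rhot s)^-1)%g = (b * x * b^-1)%g) &
      (* (4) *)
      ~~ ([set: sdprod_by act]%SET \isog PGL 1 'F_p)%g].
Proof.
have [pi_rep pi_cont _] := pi_attached.
move=> s pit rhot rhotG rhotH.
pose H := gal_over_Qi; have HE := gal_over_QiE.
have H_subgroup : subgroup_pred H := gal_over_Qi_subgroup.
have s_repr := gal_over_Qi_index2.
have H_conj g : H g -> H (s * g * s^-1)%g.
  by rewrite /H HE !moves_iM moves_iV addbC addbA addbb.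
have p0 : p%:R = 0 :> FL := red_natr EL_completion FL_residue Lambda_p.
have rho_rep := ind_matrix_rep pi_rep H_subgroup s_repr rho_ind.
have rho_int := induced_integral pi_rep pi_integral H_subgroup s_repr rho_ind.
have rhotM g h : rhot (g * h)%g = (rhot g * rhot h)%g.
  exact (@reduced_rep_hom _ _ _ _ _ _ _ EL_completion FL_residue _ 3 rho
    rho_rep rho_int (fun=> True) g h I I).
have pitM g h : pit (g * h)%g = (pit g * pit h)%g.
  exact (@reduced_rep_hom _ _ _ _ _ _ _ EL_completion FL_residue _ 1 pi
    pi_rep pi_integral (fun=> True) g h I I).
have rhot1 g : rhot g = 1%g <-> H g /\ pit g = 1%g.
  exact: (@reduced_induced_eq1 _ _ _ _ _ _ _ EL_completion FL_residue _ 1 H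
    s pi rho).
have pitP g : pit g \in PSL_Fp_in 1 p FL by rewrite -pi_image; exact: mem_img.
have [kap isokap] := PSL_Fp_in_isom 1 p_prime p0.
have pit_hom : hom_on (fun=> True) pit by move=> g h _ _.
pose D := Group (img_group_set (subgroup_predT _) pit_hom).
have DE : PSL_Fp_in 1 p FL = D by rewrite -pi_image.
move: kap isokap; rewrite DE => kap /isomP[injkap imkap].
pose q g := kap (pit g).
have Dpit g : pit g \in D by exact: mem_img.
have qM g h : q (g * h)%g = (q g * q h)%g by rewrite /q pitM morphM.
have qP g : q g \in PSL 1 'F_p by rewrite -imkap; exact: mem_morphim.
have q_eq1 g : q g = 1%g <-> pit g = 1%g.
  split=> [/eqP|pg]; last by rewrite /q pg morph1.
  by rewrite /q morph_injm_eq1 // => /eqP.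
(* The preimage in SL_2 of q(H) contains all squares, as H has index 2. *)
have q_onto y : y \in PSL 1 'F_p -> exists2 h, H h & q h = y.
  have q_surj x : x \in PSL 1 'F_p -> exists g, q g = x.
    by rewrite -imkap => /morphimP[_ _ /imgP[g _ <-] ->]; exists g.
  have q_homH : hom_on H q by move=> g h _ _.
  pose X := Group (img_group_set H_subgroup q_homH).
  pose X' := (coset (GL_scalars 1 'F_p) @*^-1 X)%G.
  have nz2 : 2%:R != 0 :> 'F_p.
    by rewrite -(dvdn_pcharf (pchar_Fp p_prime)) gtnNdvd // (leq_trans _ p_ge5).
  have sSL : SL 1 'F_p \subset X'.
    apply: SL2_generated_by_squares => // x SLx.
    apply/morphpreP; split; first exact: GL_scalars_norm.
    have [|g Dg] := q_surj (coset (GL_scalars 1 'F_p) x).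
      by apply: mem_morphim; rewrite ?GL_scalars_norm.
    rewrite morphM ?GL_scalars_norm //= -Dg -qM; apply: mem_img.
    by rewrite /H HE moves_iM addbb.
  case/morphimP => x _ /(fintype.subsetP sSL)/morphpreP[_ /imgP[h Hh Dh]] ->.
  by exists h.
have rhot_eq1 g : rhot g = 1%g <-> H g /\ q g = 1%g by rewrite q_eq1 rhot1.
have PSL_center z : (forall y, y \in PSL 1 'F_p -> (z * y = y * z)%g) -> z = 1%g.
  exact: PSL2_centralizer.
have inner := f_conj_inner HE moves_iM moves_i_conj complex_conj2
  qM rhotM qP q_onto rhot_eq1.
have [psi [act [theta [Phi]]]] := semidirect_structure HE moves_iM
  moves_i_conj complex_conj2 qM rhotM qP q_onto rhot_eq1 PSL_center.
case=> -[isopsi actE triv] PhiP [homth th1 imth] [zeta Zzeta nz_zeta].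
exists psi, act; split=> //.
- split=> //; first by exists Phi.
  have [S0 contS0] := pi_cont 1%g 1.
  rewrite -imth; apply: (finite_quotient_galois (S := 'i :: S0)) => // g fixS.
  apply/th1/rhot1; split.
    by rewrite /H HE /moves_i fixS ?eqxx // mem_head.
  have -> : pit g = @proj_class 1 FL 1%:M.
    congr proj_class; apply: (map_red_near1 EL_completion FL_residue) => i j.
    by rewrite -(pi_rep.1); apply: contS0 => x S0x; rewrite fixS // inE S0x orbT.
  by apply/(proj_class_eq1 (unitmx1 _ _)); exact: scalar_mx_is_scalar.
- by rewrite triv; exact: q_eq1.
(* zeta contradicts the triviality of the center of PGL_2. *)
apply/negP => /isog_center; rewrite PGL2_center => isoZ.
have /eqP Z1 : 'Z([set: sdprod_by act]%SET)%g == 1%g.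
  by rewrite (isog_eq1 isoZ).
by move: Zzeta; rewrite Z1 inE (negPf nz_zeta).
Qed.
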